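(* Let $X$ be a $(\mathtt P,G)$-Markov branching process on $E$ as described in the context, with extinction probability $w$ and $p=1-w$. Assume that $\inf_{x\in E}w(x)>0$ and $w(x)<1$ for all $x\in E$, and that the branching rate $\varsigma$ is uniformly bounded from above. Let $\mu=\sum_{i=1}^n\delta_{x_i}$ with $n\in\mathbb N$ and $x_1,\dots,x_n\in E$. Then $(X,\mathbb P_\mu)$ is equal in law to $$\sum_{i=1}^n\Big(\mathtt B_i\,X^{i,\updownarrow}_t+(1-\mathtt B_i)\,X^{i,\downarrow}_t\Big),\qquad t\ge0,$$ where, for each $i=1,\dots,n$, $\mathtt B_i$ is an independent Bernoulli random variable with probability of success $p(x_i)=1-w(x_i)$, and the processes $X^{i,\downarrow}$ and $X^{i,\updownarrow}$ are independent copies of $(X,\mathbb P^\downarrow_{\delta_{x_i}})$ and $(X,\mathbb P^\updownarrow_{\delta_{x_i}}(\,\cdot\mid c_\emptyset(0)=\,\uparrow))$, respectively.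
   Context: **Markov branching process (MBP).** $E\subseteq\mathbb R^d$ is a non-empty open set, $\dagger$ is an absorbing cemetery state appended to $E$, and $\mathtt P=(\mathtt P_t,t\ge0)$ is a Markov semigroup on $E$ (not necessarily conservative or Feller), given by $\mathtt P_t[f](x)=\mathbf E_x[f(\xi_t)\mathbf 1_{(t<\mathtt k)}]$, where $(\xi,\mathbf P_x)$ is a Markov process on $E\cup\{\dagger\}$ with lifetime $\mathtt k=\inf\{t>0:\xi_t=\dagger\}$. A $(\mathtt P,G)$-MBP is a process $X_t=\sum_{i=1}^{N_t}\delta_{x_i(t)}$ of finite atomic measures on $E$ in which particles move independently as copies of $\xi$ (and are removed on reaching $\dagger$) and, when at $x\in E$, branch at instantaneous rate $\varsigma(x)$; at a branching event the particle is replaced by a random number $N\ge0$ of offspring at positions $x_1,\dots,x_N\in E$ (an ordered set of points, possibly different from $x$) with law $\mathcal P_x$ (expectation $\mathcal E_x$). The branching generator is $G[f](x)=\varsigma(x)\,\mathcal E_x\big[\prod_{j=1}^Nf(x_j)-f(x)\big]$ for measurable $f:E\to[0,1]$; empty products equal $1$. $\mathbb P_\mu$ is the law of $X$ started from $X_0=\mu$, and $\mathcal F_t=\sigma(X_s,s\le t)$. **Extinction.** $\zeta=\inf\{t\ge0:\langle1,X_t\rangle=0\}$, $w(x)=\mathbb P_{\delta_x}(\zeta<\infty)$, $p(x)=1-w(x)$, with $w(\dagger)=1$, $p(\dagger)=0$. **Marks.** A particle $i$ alive at time $t$ is given the mark $c_i(t)=\,\uparrow$ (''prolific'') if it has an infinite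 genealogical line of descent, and $c_i(t)=\,\downarrow$ if its line of descent dies out. $\mathbb P^\updownarrow_{\delta_x}$ denotes the law of the resulting marked process started from one particle at $x$; $\emptyset$ denotes the initial ancestor. For $A\in\mathcal F_t$, $$\mathbb P^\downarrow_{\delta_x}(A):=\mathbb P^\updownarrow_{\delta_x}(A\mid c_\emptyset(0)=\,\downarrow)=\frac{\mathbb E_{\delta_x}\big[\mathbf 1_A\prod_{i=1}^{N_t}w(x_i(t))\big]}{w(x)},$$ $$\mathbb P^\updownarrow_{\delta_x}(A\mid c_\emptyset(0)=\,\uparrow)=\frac{\mathbb E_{\delta_x}\big[\mathbf 1_A\big(1-\prod_{i=1}^{N_t}w(x_i(t))\big)\big]}{p(x)}.$$ *)

(* Defs.v *)
From HB Require Import structures.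
From mathcomp Require Import all_boot all_order all_algebra.
From mathcomp Require Import all_classical all_reals all_analysis.
From mathcomp Require Import measurable_realfun.

Set Implicit Arguments.
Unset Strict Implicit.
Unset Printing Implicit Defensive.
Import Order.TTheory GRing.Theory Num.Theory.
Import numFieldNormedType.Exports.
Local Open Scope classical_set_scope.
Local Open Scope ring_scope.
Local Open Scope ereal_scope.

(* The state space: a non-empty subset of R^d with the Borel sigma-algebra of
   its subspace topology. *)
Section state_space.
Context {R : realType} {d : nat} {E : set 'rV[R]_d}.

Definition state_carrier (neE : E !=set0) : Type := set_type E.
HB.instance Definition _ (neE : E !=set0) := Choice.on (state_carrier neE).
HB.instance Definition _ (neE : E !=set0) :=
  isPointed.Build (state_carrier neE) (SigSub (mem_set (projT2 (cid neE)))).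

Definition state_opens (neE : E !=set0) : set (set (state_carrier neE)) :=
  [set U : set (set_type E) | open U].
Definition state (neE : E !=set0) : Type := g_sigma_algebraType (@state_opens neE).
HB.instance Definition _ (neE : E !=set0) := Measurable.on (state neE).

End state_space.

Section measurable_constructions.
Context {d : measure_display} (T : measurableType d).

(* [T] with the extra isolated point [None]. *)
Definition opt_sets : set (set (option T)) := [set Some @` B | B in measurable].
Definition opt : Type := g_sigma_algebraType opt_sets.
HB.instance Definition _ := Measurable.on opt.

(* Finite sequences over [T]; this is the sigma-algebra of the disjoint union of
   the powers T^n, since [onth s j = None] iff [size s <= j]. *)
Definition fseq_carrier : Type := seq T.
HB.instance Definition _ := Choice.on fseq_carrier.
HB.instance Definition _ := isPointed.Build fseq_carrier [::].
Definition fseq_sets : set (set fseq_carrier) :=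
  [set A | exists j B, measurable B /\
     A = [set s | exists2 x, onth s j = Some x & B x]].
Definition fseq : Type := g_sigma_algebraType fseq_sets.
HB.instance Definition _ := Measurable.on fseq.

End measurable_constructions.

Section path_space.
Context (R : realType) {d : measure_display} (E : measurableType d).

Definition measures : Type := {measure set E -> \bar R}.
HB.instance Definition _ := gen_eqMixin measures.
HB.instance Definition _ := gen_choiceMixin measures.
HB.instance Definition _ := isPointed.Build measures mzero.

(* Measure-valued paths indexed by t >= 0, with the cylinder sigma-algebra; the
   values at negative times are ignored. *)
Definition measure_path_carrier : Type := R -> measures.
HB.instance Definition _ := Pointed.on measure_path_carrier.
Definition measure_path_sets : set (set measure_path_carrier) :=
  [set A | exists t B (U : set (\bar R)), [/\ (0 <= t)%R, measurable B, measurable U &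
     A = [set X : measure_path_carrier | U ((X t : {measure set E -> \bar R}) B)]]].
Definition measure_path : Type := g_sigma_algebraType measure_path_sets.
HB.instance Definition _ := Measurable.on measure_path.

Definition madd (m1 m2 : measures) : measures :=
  measure_add (m1 : {measure set E -> \bar R}) (m2 : {measure set E -> \bar R}).

Definition mscaleb (b : bool) (m : measures) : measures :=
  mscale (b%:R%:nng)%R (m : {measure set E -> \bar R}).

End path_space.

Section probability_notions.
Context {R : realType}.

Definition equal_in_law {d1 d2 d} {O1 : measurableType d1}
    {O2 : measurableType d2} {T : measurableType d}
    (P1 : probability O1 R) (X1 : O1 -> T)
    (P2 : probability O2 R) (X2 : O2 -> T) : Prop :=
  forall A, measurable A -> P1 (X1 @^-1` A) = P2 (X2 @^-1` A).

Definition mutually_independent {d} {O : measurableType d}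
    (P : probability O R) {I : finType} (F : I -> set (set O)) : Prop :=
  forall (J : {set I}) (A : I -> set O), (forall i, i \in J -> F i (A i)) ->
    fine (P [set w | forall i, i \in J -> A i w]) =
    (\prod_(i in J) fine (P (A i)))%R.

Definition conditional {d} {O : measurableType d} (P : probability O R)
    (A C : set O) : R :=
  (fine (P (A `&` C)) / fine (P C))%R.

End probability_notions.

(* Markov processes on E with a cemetery state: [None] is the cemetery. *)
Section markov_process.
Context {R : realType} {dE dW : measure_display}.
Context (E : measurableType dE) (W : measurableType dW).

Definition lifetime (xi : R -> W -> option E) (w : W) : \bar R :=
  ereal_inf [set t%:E | t in [set t | (0 < t)%R /\ xi t w = None]].

Definition semigroup (xi : R -> W -> option E) (Px : R.-pker E ~> W)
    (t : R) (f : E -> R) (x : E) : R :=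
  Rintegral (Px x) [set w | t%:E < lifetime xi w]
    (fun w => if xi t w is Some y then f y else 0%R).

Definition history (xi : R -> W -> option E) (s : R) : set (set W) :=
  [set A | exists r (C : set (opt E)),
     [/\ (0 <= r <= s)%R, measurable C & A = [set w | C (xi r w)]]].

Record markov_process := MarkovProcess {
  motion :> R -> W -> option E ;
  motion_law : R.-pker E ~> W ;
  motion_measurable : measurable_fun [set tw : R * W | (0 <= tw.1)%R]
    (fun tw => motion tw.1 tw.2 : opt E) ;
  motion_start : forall x, {ae motion_law x, forall w, motion 0%R w = Some x} ;
  motion_absorbed : forall s t w, (0 <= s)%R -> (s <= t)%R ->
    motion s w = None -> motion t w = None ;
  motion_markov : forall s t x A (B : set E), (0 <= s)%R -> (0 <= t)%R ->
    <<s history motion s >> A -> measurable B ->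
    motion_law x (A `&` [set w | exists2 y, motion (s + t)%R w = Some y & B y]) =
    \int[motion_law x]_(w in A)
      (if motion s w is Some y
       then (semigroup motion motion_law t (\1_B) y)%:E else 0)
}.

End markov_process.

Section branching_mechanism.
Context {R : realType} {dE : measure_display} (E : measurableType dE).

Record branching_mechanism := BranchingMechanism {
  rate : E -> R ;
  rate_ge0 : forall x, (0 <= rate x)%R ;
  rate_measurable : measurable_fun setT rate ;
  offspring : R.-pker E ~> fseq E
}.

Definition branching_generator (M : branching_mechanism) (f : E -> R) (x : E)
    : R :=
  (rate M x * Rintegral (offspring M x) setT
     (fun y => \prod_(z <- (y : seq E)) f z - f x))%R.

End branching_mechanism.

(* Particles carry reversed Ulam-Harris labels: [:: i] is the i-th initial
   particle and j :: u is the j-th child of u. *)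
Definition label := seq nat.

Section genealogy.
Context {R : realType} {dE dW : measure_display}.
Context {E : measurableType dE} {W : measurableType dW}.
Variables (xi : markov_process (R := R) E W) (M : branching_mechanism (R := R) E).

(* A life is (the motion run from the birth position, an Exp(1) clock, the
   positions of the offspring). *)
Definition life : Type := (W * R * fseq E)%type.

Definition hazard (t : R) (w : W) : \bar R :=
  \int[lebesgue_measure]_(s in `[0%R, t])
    (if xi s w is Some y then (rate M y)%:E else 0).

(* The age at which the particle branches: the accumulated rate reaches the
   exponential clock, so that P(age > t | w) = exp (- hazard t w). *)
Definition branch_age (w : W) (e : R) : \bar R :=
  ereal_inf [set t%:E | t in [set t | (0 <= t)%R /\ e%:E <= hazard t w]].

(* [None] if the particle never branches. *)
Definition branch_place (w : W) (e : R) : option E :=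
  if branch_age w e is r%:E then xi r w else None.

Definition offspring_law (o : option E) (A : set (fseq E)) : \bar R :=
  if o is Some z then offspring M z A else \d_([::] : fseq E) A.

Definition life_law (x : E) (A : set life) : \bar R :=
  \int[motion_law xi x]_w \int[exponential_prob (1 : R)%R]_e
    offspring_law (branch_place w e) [set y | A (w, e, y)].

Definition opt_life_law (o : option E) (A : set (opt life)) : \bar R :=
  if o is Some x then life_law x [set l | A (Some l)]
  else \d_(None : opt life) A.

(* T u = None if the particle u is never born. *)
Definition tree : Type := label -> opt life.

(* The root [::] is not a particle; it splits at time 0 into the initial
   particles. *)
Fixpoint split_time (T : tree) (u : label) : \bar R :=
  if u is _ :: u' then
    split_time T u' + (if T u is Some (w, e, _) then branch_age w e else +oo)
  else 0.

Definition birth_place (s : seq E) (T : tree) (u : label) : option E :=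
  match u with
  | [::] => None
  | [:: i] => onth s i
  | j :: u' =>
    if T u' is Some (w, e, y) then
      if branch_place w e is Some _ then onth (y : seq E) j else None
    else None
  end.

(* [None] if u is not alive at time t. *)
Definition place (T : tree) (t : R) (u : label) : option E :=
  if u is _ :: u' then
    if T u is Some (w, _, _) then
      if (split_time T u' <= t%:E) && (t%:E < split_time T u)
      then xi (t - fine (split_time T u'))%R w else None
    else None
  else None.

(* X_t, the sum of the Dirac masses at the positions of the living particles;
   the countable set of labels is enumerated by [pickle_inv]. *)
Definition population (T : tree) (t : R) : measures R E :=
  mseries (fun k => if pickle_inv k is Some u then
                      if place T t u is Some x
                      then (\d_x : {measure set E -> \bar R}) else mzero
                    else mzero) 0.

Definition dies_out (T : tree) (t : R) (u : label) : Prop :=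
  exists2 s, (t <= s)%R & forall v : label, suffix u v -> place T s v = None.

End genealogy.

Inductive mark := Prolific | Doomed.

Section markov_branching_process.
Context {R : realType} {dE dW dO : measure_display}.
Context {E : measurableType dE} (W : measurableType dW) (O : measurableType dO).

Definition generation_sets (T : O -> label -> opt (life (R := R) (E := E) (W := W)))
    (n : nat) : set (set O) :=
  [set A | exists (u : label) B,
     [/\ (0 < size u <= n)%N, measurable B & A = [set o | B (T o u)]]].

(* The law of the process started from the atomic measure with atoms (counted
   with multiplicity) s_0, ..., s_(n-1) is [mbp_law s]. [mbp_branching] says
   that, given the lives of the first n generations, the lives of the particles
   of generation n + 1 are independent, each with law [life_law] from its birth
   place. *)
Record mbp (P : R -> (E -> R) -> E -> R) (G : (E -> R) -> E -> R) := MBP {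
  mbp_motion : markov_process (R := R) E W ;
  mbp_mechanism : branching_mechanism (R := R) E ;
  mbp_semigroup : forall (t : R) (f : E -> R), (0 <= t)%R -> measurable_fun setT f ->
    (exists C, forall x, (`|f x| <= C)%R) ->
    P t f =1 semigroup mbp_motion (motion_law mbp_motion) t f ;
  mbp_generator : forall f : E -> R, measurable_fun setT f ->
    (forall x, (0 <= f x <= 1)%R) -> G f =1 branching_generator mbp_mechanism f ;
  mbp_tree : O -> tree (R := R) (E := E) (W := W) ;
  mbp_law : seq E -> probability O R ;
  mbp_tree_measurable : forall u, measurable_fun setT (fun o => mbp_tree o u) ;
  mbp_tree_closed : forall o j u, u <> [::] -> mbp_tree o (j :: u) <> None ->
    birth_place mbp_motion mbp_mechanism [::] (mbp_tree o) (j :: u) <> None ;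
  mbp_finite : forall o t, (0 <= t)%R ->
    (population mbp_motion mbp_mechanism (mbp_tree o) t
       : {measure set E -> \bar R}) setT < +oo ;
  mbp_branching : forall (s : seq E) (n : nat) (A : set O) (us : seq label)
      (B : label -> set (opt (life (R := R) (E := E) (W := W)))),
    <<s generation_sets mbp_tree n >> A ->
    uniq us -> (forall u, u \in us -> size u = n.+1) ->
    (forall u, measurable (B u)) ->
    mbp_law s (A `&` [set o | forall u, u \in us -> B u (mbp_tree o u)]) =
    \int[mbp_law s]_(o in A) \big[*%E/1%E]_(u <- us)
      opt_life_law mbp_motion mbp_mechanism
        (birth_place mbp_motion mbp_mechanism s (mbp_tree o) u) (B u)
}.

Context {P : R -> (E -> R) -> E -> R} {G : (E -> R) -> E -> R}.
Variable X : mbp P G.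

Definition mbp_path (o : O) : measure_path R E :=
  population (mbp_motion X) (mbp_mechanism X) (mbp_tree X o).

Definition extinction_time (o : O) : \bar R :=
  ereal_inf [set t%:E | t in
    [set t | (0 <= t)%R /\ (mbp_path o t : {measure set E -> \bar R}) setT = 0]].

Definition extinction_prob (x : E) : R :=
  fine (mbp_law X [:: x] [set o | extinction_time o < +oo]).

Definition mark_at (u : label) (t : R) (o : O) : mark :=
  if `[< dies_out (mbp_motion X) (mbp_mechanism X) (mbp_tree X o) t u >]
  then Doomed else Prolific.

(* The law of X started from one particle at x, conditioned on the mark at time
   0 of the initial ancestor, whose label is [:: 0]. *)
Definition conditioned_law (x : E) (c : mark) (A : set (measure_path R E)) : R :=
  conditional (mbp_law X [:: x]) (mbp_path @^-1` A)
    [set o | mark_at [:: 0%N] 0%R o = c].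

End markov_branching_process.

(* Main.v *)
Require Import Defs.
From HB Require Import structures.
From mathcomp Require Import all_boot all_order all_algebra.
From mathcomp Require Import all_classical all_reals all_analysis.
From mathcomp Require Import measurable_realfun.

Set Implicit Arguments.
Unset Strict Implicit.
Unset Printing Implicit Defensive.
Import Order.TTheory GRing.Theory Num.Theory.
Import numFieldNormedType.Exports.
Local Open Scope classical_set_scope.
Local Open Scope ring_scope.

(* The tree of lives is built generation by generation, and given the first n
   generations the lives of the next one are independent with laws fixed by the
   birth places; so its law is determined by the initial positions. The tree
   obtained by grafting independent trees started from [:: a] and from s obeys
   the recursion of the tree started from a :: s, whence the branching property:
   the path from a :: s is distributed as the sum of independent paths from
   [:: a] and s. Extinction is absorbing, so the mark of the initial ancestor is
   a measurable function of the path, equal to "doomed" with probability w, and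
   by the law of total probability the two conditional laws mixed with weights p
   and w give back the unconditioned law of the path from one particle. *)

(** * Measurability of the genealogical tree *)

(** Labels are reversed, so the last entry of a label names the initial ancestor and is constant
    along a line of descent. Grafting is therefore a renumbering of last entries. An event of the
    first n generations of the grafted tree is not a rectangle in the two trees, but its sections
    are events of the first n generations of one tree, and Fubini's theorem works with sections.

    Hence the path of this single family ([solo_path]) is carried along; it agrees almost surely
    with the path started from one particle.

    The bounds 0 < w < 1 keep both conditionings nondegenerate: the Bernoulli weights p and w then
    cancel the denominators of the conditional laws. *)

Lemma measurable_fun_generated {d : measure_display} {X : measurableType d}
  {Y : pointedType} (G : set (set Y)) (f : X -> Y) :
  (forall A, G A -> measurable (f @^-1` A)) ->
  measurable_fun setT (f : X -> g_sigma_algebraType G).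
Proof.
move=> mf; apply: (@measurability _ _ X (g_sigma_algebraType G) _ _ G) => //.
by move=> _ [A GA <-]; rewrite setTI; exact: mf.
Qed.

Section measurable_option.
Context {d d1 d2 : measure_display}.
Context {T : measurableType d} {U : measurableType d1} {V : measurableType d2}.

Lemma measurable_Some : measurable_fun [set: T] (Some : T -> opt T).
Proof.
apply: measurable_fun_generated => _ [B mB <-].
rewrite (_ : _ @^-1` _ = B)//.
by apply/seteqP; split => [x [y By [<-]]|x Bx] //; exists x.
Qed.

Lemma measurable_image_Some (B : set T) :
  measurable B -> measurable (Some @` B : set (opt T)).
Proof. by move=> mB; apply: sub_sigma_algebra; exists B. Qed.

Lemma measurable_isSome : measurable_fun [set: opt T] (fun o : opt T => isSome o).
Proof.
apply: (measurable_fun_bool true); rewrite setTI.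
rewrite (_ : _ @^-1` _ = Some @` [set: T]); first exact: measurable_image_Some.
by apply/seteqP; split => [[x|]//= _|_ [x _ <-]//]; exists x.
Qed.

Lemma measurable_odflt : measurable_fun [set: opt T] (odflt point : opt T -> T).
Proof.
move=> _ B mB; rewrite setTI.
rewrite (_ : _ @^-1` B = Some @` B `|`
    (~` (Some @` [set: T]) `&` [set o : opt T | B point])).
  apply: measurableU; first exact: measurable_image_Some.
  apply: measurableI.
    exact: (@measurableC _ (opt T) _ (measurable_image_Some measurableT)).
  have [Bp|Bp] := pselect (B point).
    rewrite (_ : [set _ | _] = setT); last by apply/seteqP; split.
    exact: (@measurableT _ (opt T)).
  rewrite (_ : [set _ | _] = set0); last by apply/seteqP; split.
  exact: (@measurable0 _ (opt T)).
apply/seteqP; split => [[x|]/= Bx|].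
- by left; exists x.
- by right; split => // -[].
- by move=> o [[x Bx <-//]|[+ /= Bp]]; case: o Bp => //= x Bp []; exists x.
Qed.

(** The match becomes an [if] on [isSome], with [odflt point] as a total measurable projection. [F]
    is jointly measurable because a branch may use both the matched value and the ambient
    variable. *)
Lemma measurable_fun_omatch (h : U -> opt T) (F : U * T -> V) (c : U -> V) :
  measurable_fun setT h -> measurable_fun setT F -> measurable_fun setT c ->
  measurable_fun setT (fun x => if h x is Some y then F (x, y) else c x).
Proof.
move=> mh mF mc.
rewrite (_ : (fun x => _) = (fun x => if isSome (h x) then
    F (x, odflt point (h x)) else c x)); last by apply/funext => x; case: (h x).
apply: measurable_fun_ifT => //.
- exact: (measurableT_comp measurable_isSome).
- apply: (measurableT_comp mF); apply: measurable_fun_pair => //.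
  exact: (measurableT_comp measurable_odflt).
Qed.

End measurable_option.

(** [None] is a measurable atom, so only the restriction to [Some] carries a condition. *)
Lemma measurable_fun_opt {d d2} {T : measurableType d} {V : measurableType d2}
  (h : opt T -> V) :
  measurable_fun setT (h \o Some) -> measurable_fun setT h.
Proof.
move=> mh.
rewrite (_ : h = (fun o => if id o is Some y then ((h \o Some) \o snd) (o, y)
    else cst (h None) o)); last by apply/funext => -[].
apply: (measurable_fun_omatch (h := id : opt T -> opt T)) => //.
exact: (measurableT_comp mh measurable_snd).
Qed.

Lemma measurable_onth {d} {T : measurableType d} (j : nat) :
  measurable_fun setT ((fun s => onth s j) : fseq T -> opt T).
Proof.
apply: measurable_fun_generated => _ [B mB <-].
apply: sub_sigma_algebra; exists j, B; split => //.
apply/seteqP; split => [s [x Bx sx]|s [x sx Bx]].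
  by exists x.
by exists x => //; rewrite sx.
Qed.

Section life_measurability.
Context {R : realType} {dE dW : measure_display}.
Context {E : measurableType dE} {W : measurableType dW}.
Variables (xi : markov_process (R := R) E W) (M : branching_mechanism (R := R) E).
Local Open Scope ereal_scope.

Lemma measurable_motion {d} {U : measurableType d} (f : U -> R) (g : U -> W) :
  measurable_fun setT f -> measurable_fun setT g -> (forall x, (0 <= f x)%R) ->
  measurable_fun setT (fun x => xi (f x) (g x) : opt E).
Proof.
move=> mf mg f0.
have mD : measurable [set tw : R * W | (0 <= tw.1)%R].
  rewrite (_ : [set _ | _] = fst @^-1` `[0%R, +oo[%classic); last first.
    by apply/seteqP; split => x /=; rewrite in_itv/= andbT.
  by rewrite -[X in measurable X]setTI; exact: measurable_fst.
apply: (measurable_comp (F := [set tw : R * W | (0 <= tw.1)%R])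
  (f := fun tw => xi tw.1 tw.2 : opt E) (g := fun x => (f x, g x))) => //.
- by move=> _ [x _ <-]/=.
- exact: motion_measurable.
- exact: measurable_fun_pair.
Qed.

(** The motion is jointly measurable at nonnegative times only. Replacing s by its maximum with 0
    gives a globally measurable integrand, and [hazardE] shows that the integral over [0, t] is
    unchanged. *)
Lemma measurable_hazard_integrand :
  measurable_fun setT (fun sw : R * W =>
    if xi (Num.max 0 sw.1)%R sw.2 is Some y then (rate M y)%:E else 0).
Proof.
apply: (measurable_fun_omatch
  (h := fun sw : R * W => xi (Num.max 0 sw.1)%R sw.2 : opt E)
  (F := fun p => (rate M p.2)%:E) (c := cst 0)) => //.
- apply: measurable_motion; last by move=> x; rewrite le_max lexx.
    exact: measurable_maxr.
  exact: measurable_snd.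
- apply/measurable_EFinP; apply: (measurableT_comp (rate_measurable M)).
  exact: measurable_snd.
Qed.

Lemma hazardE t w : hazard xi M t w =
  \int[lebesgue_measure]_(s in `[0%R, t])
    (if xi (Num.max 0 s)%R w is Some y then (rate M y)%:E else 0).
Proof.
apply: eq_integral => s; rewrite inE/= in_itv/= => /andP[s0 _].
by rewrite (max_idPr s0).
Qed.

Lemma measurable_hazard t : measurable_fun setT (hazard xi M t).
Proof.
rewrite (_ : hazard xi M t = fun w => \int[lebesgue_measure]_s
   (if s \in `[0%R, t] then
      if xi (Num.max 0 s)%R w is Some y then (rate M y)%:E else 0 else 0)).
  apply: (measurable_fun_fubini_tonelli_G (m1 := lebesgue_measure)
    (fun sw : R * W => if sw.1 \in `[0%R, t] then
      if xi (Num.max 0 sw.1)%R sw.2 is Some y then (rate M y)%:E else 0 else 0)).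
  - apply: measurable_fun_ifT => //; last exact: measurable_hazard_integrand.
    apply: (measurable_fun_bool true); rewrite setTI.
    rewrite (_ : _ @^-1` _ = fst @^-1` `[0%R, t]%classic)//.
    by rewrite -[X in measurable X]setTI; exact: measurable_fst.
  - move=> [s w]/=; case: ifPn => // _; case: (xi _ _) => // y.
    by rewrite lee_fin rate_ge0.
apply/funext => w; rewrite hazardE integral_mkcond; apply: eq_integral => s _.
by rewrite patchE mem_setE.
Qed.

Lemma nondecreasing_hazard w :
  {homo (fun t => hazard xi M t w) : s t / (s <= t)%R >-> s <= t}.
Proof.
move=> s t st; rewrite !hazardE; apply: ge0_subset_integral => //.
- apply: measurable_funTS.
  exact: (measurableT_comp measurable_hazard_integrand (pair2_measurable w)).
- by move=> u _; case: (xi _ _) => // y; rewrite lee_fin rate_ge0.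
- by apply: subset_itvl; rewrite bnd_simp.
Qed.

Lemma branch_age_ge0 w e : 0 <= branch_age xi M w e.
Proof. by apply: le_ereal_inf_tmp => _ [t [t0 _] <-]; rewrite lee_fin. Qed.

(** The hazard is nondecreasing, so the age is below r exactly when the clock is already reached at
    some rational q in [0, r). This makes the event a countable union. *)
Lemma measurable_branch_age :
  measurable_fun setT (fun we : W * R => branch_age xi M we.1 we.2).
Proof.
apply: (measurability _ (ErealGenInftyO.measurableE R)) => _ [_ [r ->] <-].
rewrite setTI (_ : _ @^-1` _ = \bigcup_(q : rat)
    [set we : W * R | [&& (0 <= (ratr q : R))%R, ((ratr q : R) < r)%R &
       we.2%:E <= hazard xi M (ratr q) we.1]]); last first.
  apply/seteqP; split => [[w e]/=|[w e]/=].
    rewrite in_itv/= => /ereal_inf_lt[_ [t [t0 et] <-]]; rewrite lte_fin => tr.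
    have [q] := rat_in_itvoo tr; rewrite in_itv/= => /andP[tq qr].
    exists q => //=; rewrite (le_trans t0 (ltW tq)) qr/=.
    by rewrite (le_trans et)// nondecreasing_hazard// ltW.
  move=> [q _ /and3P[q0 qr eq]]; rewrite in_itv/=.
  apply: (@le_lt_trans _ _ (ratr q : R)%:E); last by rewrite lte_fin.
  by apply: ereal_inf_lbound; exists (ratr q).
apply: bigcupT_measurable_rat => q.
have [q0|_] := boolP (0 <= (ratr q : R))%R; last first.
  by rewrite (_ : [set _ | _] = set0) ?measurable0//; apply/seteqP; split.
have [qr|_] := boolP ((ratr q : R) < r)%R; last first.
  by rewrite (_ : [set _ | _] = set0) ?measurable0//; apply/seteqP; split.
rewrite (_ : [set _ | _] = setT `&`
    [set we : W * R | we.2%:E <= hazard xi M (ratr q) we.1]); last first.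
  by rewrite setTI.
apply: measurable_lee => //.
- by apply/measurable_EFinP; exact: measurable_snd.
- exact: (measurableT_comp (measurable_hazard _) measurable_fst).
Qed.

Lemma measurable_branch_place :
  measurable_fun setT (fun we : W * R => branch_place xi M we.1 we.2 : opt E).
Proof.
rewrite (_ : (fun _ => _) = fun we : W * R =>
    if branch_age xi M we.1 we.2 \is a fin_num
    then xi (fine (branch_age xi M we.1 we.2)) we.1 else None); last first.
  by apply/funext => we; rewrite /branch_place; case: branch_age.
apply: (@measurable_fun_ifT _ _ _ (opt E)).
- apply: (measurable_fun_bool true).
  exact: emeasurable_fin_num measurable_branch_age.
- apply: measurable_motion.
  + exact: (measurableT_comp (fine_measurable _) measurable_branch_age).
  + exact: measurable_fst.
  + by move=> we; rewrite fine_ge0// branch_age_ge0.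
- exact: measurable_cst.
Qed.

(** The offspring kernel with an idle parameter in Z. With it, the measure of a section depending on
    that parameter is the integral of an indicator against a kernel, hence jointly measurable. *)
Definition offspring_fst {d} {Z : measurableType d} (p : E * Z) :
  {measure set (fseq E) -> \bar R} := offspring M p.1.

Section offspring_fst_kernel.
Context {d} {Z : measurableType d}.

Let measurable_offspring_fst (U : set (fseq E)) : measurable U ->
  measurable_fun [set: E * Z] (fun p => @offspring_fst d Z p U).
Proof.
by move=> mU; apply: (measurableT_comp (measurable_kernel (offspring M) U mU)).
Qed.

HB.instance Definition _ :=
  isKernel.Build _ _ _ _ _ (@offspring_fst d Z) measurable_offspring_fst.

Let offspring_fst_prob p : (@offspring_fst d Z) p setT = 1.
Proof. exact: prob_kernel. Qed.

HB.instance Definition _ :=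
  Kernel_isProbability.Build _ _ _ _ _ (@offspring_fst d Z) offspring_fst_prob.

Lemma measurable_offspring_section (A : set (Z * fseq E)) : measurable A ->
  measurable_fun setT (fun p : E * Z => offspring M p.1 [set y | A (p.2, y)]).
Proof.
move=> mA.
have mA' : measurable [set q : E * Z * fseq E | A (q.1.2, q.2)].
  rewrite -[X in measurable X]setTI.
  have mf : measurable_fun setT (fun q : E * Z * fseq E => (q.1.2, q.2)).
    apply: measurable_fun_pair; last exact: measurable_snd.
    exact: (measurableT_comp measurable_snd measurable_fst).
  exact: mf.
have := @measurable_kfcomp _ _ _ _ _ (@offspring_fst d Z)
  (EFin \o \1_[set q : E * Z * fseq E | A (q.1.2, q.2)]).
rewrite kfcompkindic// => h.
rewrite (_ : (fun _ => _) = (fun p : E * Z => offspring_fst p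
  (xsection [set q : E * Z * fseq E | A (q.1.2, q.2)] p))); last first.
  apply/funext => p; rewrite /offspring_fst; congr (offspring M _ _).
  by apply/seteqP; split => y; rewrite /xsection/= inE.
apply: h; first by apply/measurable_EFinP; exact: measurable_indic.
by move=> ?; rewrite lee_fin.
Qed.

End offspring_fst_kernel.

Lemma measurable_life_law (A : set (life (R := R) (E := E) (W := W))) :
  measurable A -> measurable_fun setT (fun x => life_law xi M x A).
Proof.
move=> mA.
(* [exponential_prob] is a probability only at a positive rate; this names the structure attached to
   the proof of 0 < 1, which Tonelli's theorem requires. *)
pose m :=
  exponential_distribution_exponential_prob__canonical__probability_measure_Probability
    (ltr01 : 0 < 1 :> R)%R.
have mF : measurable_fun setT (fun we : W * R => offspring_law M
    (branch_place xi M we.1 we.2) [set y | A (we.1, we.2, y)]).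
  apply: (measurable_fun_omatch
    (h := fun we : W * R => branch_place xi M we.1 we.2 : opt E)
    (F := fun p => offspring M p.2 [set y | A (p.1.1, p.1.2, y)])
    (c := fun we => \d_([::] : fseq E) [set y | A (we.1, we.2, y)])) => /=.
  - exact: measurable_branch_place.
  - rewrite (_ : (fun _ => _) = (fun p : E * (W * R) =>
      offspring M p.1 [set y | A (p.2.1, p.2.2, y)]) \o (fun p => (p.2, p.1)))//.
    apply: measurableT_comp; last first.
      by apply: measurable_fun_pair; [exact: measurable_snd|exact: measurable_fst].
    apply: (@measurable_offspring_section _ _
      [set p : (W * R) * fseq E | A (p.1.1, p.1.2, p.2)]).
    by rewrite (_ : [set _ | _] = A)//; apply/seteqP; split => [] [[]].
  - rewrite (_ : (fun _ => _) =
      (fun we => (\1_[set we : W * R | A (we.1, we.2, [::] : fseq E)] we)%:E))//.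
    apply/measurable_EFinP/measurable_indic.
    rewrite -[X in measurable X]setTI.
    rewrite (_ : [set _ | _] = (fun we => (we, [::] : fseq E)) @^-1` A).
      have mp := @pair2_measurable _ _ (W * R)%type (fseq E) [::].
      exact: (mp measurableT _ mA).
    by apply/seteqP; split => [] [].
apply: measurable_fun_integral_kernel.
- exact: measurable_kernel.
- move=> w; apply: (@integral_ge0 _ _ _ m) => e _.
  by rewrite /offspring_law; case: branch_place.
apply: (measurable_fun_fubini_tonelli_F (m2 := m) (fun we : W * R =>
  offspring_law M (branch_place xi M we.1 we.2) [set y | A (we.1, we.2, y)])).
  exact: mF.
by move=> we; rewrite /offspring_law; case: branch_place.
Qed.

Lemma life_law_ge0 x (A : set (life (R := R) (E := E) (W := W))) :
  0 <= life_law xi M x A.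
Proof.
pose m :=
  exponential_distribution_exponential_prob__canonical__probability_measure_Probability
    (ltr01 : 0 < 1 :> R)%R.
apply: integral_ge0 => w _; apply: (@integral_ge0 _ _ _ m) => e _.
by rewrite /offspring_law; case: branch_place.
Qed.

Lemma measurable_opt_life_law
    (B : set (opt (life (R := R) (E := E) (W := W)))) : measurable B ->
  measurable_fun setT (fun o : opt E => opt_life_law xi M o B).
Proof.
move=> mB; apply: measurable_fun_opt.
apply: (@measurable_life_law [set l | B (Some l)]).
by rewrite -[X in measurable X]setTI; exact: measurable_Some.
Qed.

Lemma opt_life_law_ge0 o (B : set (opt (life (R := R) (E := E) (W := W)))) :
  0 <= opt_life_law xi M o B.
Proof. by case: o => [x|] //=; exact: life_law_ge0. Qed.

End life_measurability.

(** * The space of trees, and the population as a function of the tree *)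

Section tree_space.
Context {R : realType} {dE dW : measure_display}.
Context {E : measurableType dE} {W : measurableType dW}.
Variables (xi : markov_process (R := R) E W) (M : branching_mechanism (R := R) E).
Local Open Scope ereal_scope.
Notation tree := (tree (R := R) (E := E) (W := W)).
Notation life := (life (R := R) (E := E) (W := W)).

(** Cylinders over the labels in [D] alone: one construction yields both the whole tree and the
    filtration by generations. *)
Definition tree_sets (D : set label) : set (set tree) :=
  [set A | exists u (B : set (opt life)),
     [/\ D u, measurable B & A = [set T : tree | B (T u)]]].
Definition tree_space (D : set label) : Type := g_sigma_algebraType (tree_sets D).
HB.instance Definition _ (D : set label) := Measurable.on (tree_space D).

Lemma measurable_tree_coord D u : D u ->
  measurable_fun setT ((fun T => T u) : tree_space D -> opt life).
Proof.
move=> Du _ B mB; rewrite setTI.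
by apply: sub_sigma_algebra; exists u, B.
Qed.

Lemma measurable_fun_tree {d} {X : measurableType d} (D : set label) (f : X -> tree) :
  (forall u, D u -> measurable_fun setT (fun x => f x u : opt life)) ->
  measurable_fun setT (f : X -> tree_space D).
Proof.
move=> mf; apply: measurable_fun_generated => _ [u [B [Du mB ->]]].
by rewrite -[X in measurable X]setTI; exact: mf.
Qed.

(** A birth place reads only the life of the parent, or the initial positions. Hence the birth
    places of generation n + 1 are measurable for the first n generations. *)
Lemma measurable_birth_place (D : set label) (s : seq E) (u : label) :
  (forall j v, u = j :: v -> v <> [::] -> D v) ->
  measurable_fun setT (fun T : tree_space D => birth_place xi M s T u : opt E).
Proof.
case: u => [|j [|i v]] Du; [exact: measurable_cst|exact: measurable_cst|].
rewrite (_ : (fun _ => _) = (fun o : opt life => if o is Some (w, e, y) then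
    if branch_place xi M w e is Some _ then onth (y : seq E) j else None
    else None) \o (fun T : tree_space D => T (i :: v)))//.
apply: measurableT_comp; last first.
  by apply: measurable_tree_coord; apply: (Du j).
apply: measurable_fun_opt.
rewrite (_ : _ \o _ = fun l : life =>
  if branch_place xi M l.1.1 l.1.2 is Some x then onth (l, x).1.2 j else None);
  last by apply/funext => -[[]].
apply: (measurable_fun_omatch
  (h := fun l : life => branch_place xi M l.1.1 l.1.2 : opt E)
  (F := (fun p : life * E => onth p.1.2 j : opt E))
  (c := (cst None : life -> opt E))) => //.
- apply: (measurableT_comp (f := fun we => branch_place xi M we.1 we.2 : opt E)
    (g := fst)) => //; exact: measurable_branch_place.
- apply: (measurableT_comp (f := (fun y => onth y j) : fseq E -> opt E)).
    exact: measurable_onth.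
  exact: (measurableT_comp measurable_snd measurable_fst).
Qed.

(** The branching relation says nothing about the coordinate at the root [[::]], so that coordinate
    is kept out of the sigma-algebra on which laws are compared. *)
Definition particles : set label := [set u | u <> [::]].

Lemma split_time_ge0 (T : tree) u : 0 <= split_time xi M T u.
Proof.
elim: u => [|j u IH] //=; apply: adde_ge0 => //.
by case: (T _) => [[[w e] y]|//]; exact: branch_age_ge0.
Qed.

Lemma measurable_split_time u :
  measurable_fun setT (fun T : tree_space particles => split_time xi M T u).
Proof.
elim: u => [|j u IH]; first exact: measurable_cst.
apply: emeasurable_funD => //.
apply: (measurableT_comp (f := fun o : opt life =>
  if o is Some (w, e, _) then branch_age xi M w e else +oo)
  (g := fun T : tree_space particles => T (j :: u))); last first.
  exact: measurable_tree_coord.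
apply: measurable_fun_opt.
rewrite (_ : _ \o _ = (fun we => branch_age xi M we.1 we.2) \o fst); last first.
  by apply/funext => -[[]].
exact: (measurableT_comp (measurable_branch_age xi M) measurable_fst).
Qed.

Lemma place_cons (T : tree) (t : R) j u : place xi M T t (j :: u) =
  if T (j :: u) is Some l then
    if (split_time xi M T u <= t%:E) && (t%:E < split_time xi M T (j :: u))
    then xi (t - fine (split_time xi M T u))%R l.1.1 else None
  else None.
Proof. by rewrite /=; case: (T _) => [[[w e] y]|]. Qed.

(* The motion is only measurable on nonnegative times, whence the maximum. *)
Lemma place_maxE (T : tree) (t : R) j u : place xi M T t (j :: u) =
  if T (j :: u) is Some l then
    if (split_time xi M T u <= t%:E) && (t%:E < split_time xi M T (j :: u))
    then xi (Num.max 0 (t - fine (split_time xi M T u)))%R l.1.1 else None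
  else None.
Proof.
rewrite place_cons; case: (T _) => // l.
case: ifPn => // /andP[st _]; congr (xi _ _); apply/esym/max_idPr.
have := split_time_ge0 T u; move: st.
by case: (split_time _ _ _ _) => [r| |]//=; rewrite ?lee_fin ?leey_eq// subr_ge0.
Qed.

Lemma measurable_place (t : R) u :
  measurable_fun setT (fun T : tree_space particles => place xi M T t u : opt E).
Proof.
case: u => [|j u]; first exact: measurable_cst.
rewrite (_ : (fun _ => _) = (fun T : tree_space particles =>
  if T (j :: u) is Some l then
    if (split_time xi M T u <= t%:E) && (t%:E < split_time xi M T (j :: u))
    then xi (Num.max 0 (t - fine (split_time xi M T u)))%R (T, l).2.1.1 else None
  else None)); last by apply/funext => T; rewrite place_maxE.
apply: (@measurable_fun_omatch _ _ _ life (tree_space particles) (opt E)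
  (fun T : tree_space particles => T (j :: u))
  (fun p : tree_space particles * life =>
    if (split_time xi M p.1 u <= t%:E) && (t%:E < split_time xi M p.1 (j :: u))
    then xi (Num.max 0 (t - fine (split_time xi M p.1 u)))%R p.2.1.1
    else None) (cst None)) => //.
  exact: measurable_tree_coord.
have ms v : measurable_fun setT
    (fun p : tree_space particles * life => split_time xi M p.1 v).
  by apply: (measurableT_comp (measurable_split_time v)); exact: measurable_fst.
apply: (@measurable_fun_ifT _ _ _ (opt E)) => //.
- by apply: measurable_and; [exact: measurable_fun_lee|exact: measurable_fun_lte].
- apply: measurable_motion; last by move=> p; rewrite le_max lexx.
    apply: measurable_maxr => //; apply: measurable_funB => //.
    exact: (measurableT_comp (fine_measurable _) (ms u)).
  apply: (measurableT_comp measurable_fst).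
  exact: (measurableT_comp measurable_fst measurable_snd).
Qed.

Definition occupation (T : tree) (t : R) (B : set E) (u : label) : \bar R :=
  if place xi M T t u is Some x then \d_x B else 0.

Lemma occupation_ge0 T t B u : 0 <= occupation T t B u.
Proof. by rewrite /occupation; case: place. Qed.

Lemma population_sum (T : tree) (t : R) (B : set E) :
  (population xi M T t : {measure set E -> \bar R}) B =
  \sum_(k <oo) if pickle_inv k is Some u then occupation T t B u else 0.
Proof.
apply: eq_eseriesr => k _; case: pickle_inv => // u.
by rewrite /occupation; case: place.
Qed.

(** The enumerated series suits measurability, but splitting the population into families calls for
    an unordered sum over labels. Codes of no label contribute 0. *)
Lemma populationE (T : tree) (t : R) (B : set E) :
  (population xi M T t : {measure set E -> \bar R}) B =
  \esum_(u in [set: label]) occupation T t B u.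
Proof.
rewrite population_sum nneseries_esumT; last first.
  by move=> k; case: pickle_inv => // u; exact: occupation_ge0.
rewrite (esumID (range (pickle : label -> nat))); last first.
  by move=> k _; case: pickle_inv => // u; exact: occupation_ge0.
rewrite !setTI [X in _ + X]esum1 ?adde0; last first.
  move=> k /= kN; case uk : pickle_inv => [u|//].
  by case: kN; exists u => //; have := @pickle_invK label k; rewrite uk.
rewrite (reindex_esum [set: label] _ pickle).
  by apply: eq_esum => u _; rewrite pickleK_inv.
split.
- by move=> u _; exists u.
- by move=> u v _ _; apply: (pcan_inj pickleK).
- by move=> _ [u _ <-]; exists u.
Qed.

Lemma measurable_population :
  measurable_fun setT (population xi M : tree_space particles -> measure_path R E).
Proof.
apply: measurable_fun_generated => _ [t [B [U [t0 mB mU ->]]]].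
rewrite (_ : _ @^-1` _ = (fun T : tree_space particles =>
  (population xi M T t : {measure set E -> \bar R}) B) @^-1` U)//.
rewrite -[X in measurable X]setTI.
apply: (_ : measurable_fun setT _) => //.
rewrite (_ : (fun _ => _) = fun T : tree_space particles =>
  \sum_(k <oo) if pickle_inv k is Some u then occupation T t B u else 0); last first.
  by apply/funext => T; exact: population_sum.
apply: ge0_emeasurable_sum.
  by move=> k T _ _; case: pickle_inv => // u; exact: occupation_ge0.
move=> k _; case: pickle_inv => [u|]; last exact: measurable_cst.
rewrite /occupation.
apply: (measurableT_comp (f := fun o : opt E => if o is Some x then \d_x B else 0)
  (g := fun T : tree_space particles => place xi M T t u)).
  apply: measurable_fun_opt; apply/measurable_EFinP.
  exact: measurable_indic.
exact: measurable_place.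
Qed.
End tree_space.

(** * Uniqueness of the law of the tree *)

Lemma sub_generated_sigma {X : Type} (G H : set (set X)) :
  G `<=` <<s H >> -> <<s G >> `<=` <<s H >>.
Proof. by apply: smallest_sub; exact: smallest_sigma_algebra. Qed.

(** The pi-lambda theorem for image measures. Adding the whole space to [G] supplies the exhausting
    sequence. Finite measures of any mass are allowed, since a law restricted to an event is later
    compared with a multiple of a product law. *)
Lemma eq_pushforward_generated {R : realType} {d1 d2 : measure_display}
    {O1 : measurableType d1} {O2 : measurableType d2} {X : pointedType}
    (G : set (set X)) (m1 : {measure set O1 -> \bar R})
    (m2 : {measure set O2 -> \bar R}) (f1 : O1 -> X) (f2 : O2 -> X) :
  (forall A, G A -> measurable (f1 @^-1` A)) ->
  (forall A, G A -> measurable (f2 @^-1` A)) ->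
  setI_closed G -> m1 setT = m2 setT -> (m1 setT < +oo)%E ->
  (forall A, G A -> m1 (f1 @^-1` A) = m2 (f2 @^-1` A)) ->
  forall A, <<s G >> A -> m1 (f1 @^-1` A) = m2 (f2 @^-1` A).
Proof.
move=> mf1 mf2 GI m12T m1oo m12 A GA.
pose XG : measurableType _ := g_sigma_algebraType G.
have mF1 : measurable_fun setT (f1 : O1 -> XG) by exact: measurable_fun_generated.
have mF2 : measurable_fun setT (f2 : O2 -> XG) by exact: measurable_fun_generated.
pose F1 : {mfun O1 >-> XG} := HB.pack f1 (isMeasurableFun.Build _ _ _ _ _ mF1).
pose F2 : {mfun O2 >-> XG} := HB.pack f2 (isMeasurableFun.Build _ _ _ _ _ mF2).
have GG' : G `<=` [set B | G B \/ B = setT] by move=> B; left.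
apply: (@g_sigma_algebra_measure_unique _ R XG [set B | G B \/ B = setT] _
  (fun _ => setT) _ _ (pushforward m1 F1) (pushforward m2 F2)).
- move=> B [GB|->]; last exact: measurableT.
  exact: sub_sigma_algebra.
- by move=> _; right.
- by rewrite bigcup_const//; exists 0%N.
- move=> B C [GB|->] [GC|->]; rewrite ?setTI ?setIT; [|by left|by left|by right].
  by left; exact: GI.
- by move=> B [/m12//|->]; exact: m12T.
- by move=> _; exact: m1oo.
- by apply: sub_generated_sigma GA => B GB; apply: sub_sigma_algebra; left.
Qed.

Section branching_law.
Context {R : realType} {dE dW : measure_display}.
Context {E : measurableType dE} {W : measurableType dW}.
Variables (xi : markov_process (R := R) E W) (M : branching_mechanism (R := R) E).
Local Open Scope ereal_scope.
Notation tree := (tree (R := R) (E := E) (W := W)).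
Notation life := (life (R := R) (E := E) (W := W)).

Definition generations (n : nat) : set label := [set u | (0 < size u <= n)%N].

(** The recursion of [mbp_branching] detached from the record [mbp], with past events taken in the
    space of trees: it can then be stated for a grafted tree on a product space. *)
Definition branching_law {d} {O : measurableType d} (P : {measure set O -> \bar R})
    (T : O -> tree) (s : seq E) : Prop :=
  forall n (A : set tree) (us : seq label) (B : label -> set (opt life)),
    <<s tree_sets (generations n) >> A ->
    uniq us -> (forall u, u \in us -> size u = n.+1) ->
    (forall u, measurable (B u)) ->
    P (T @^-1` (A `&` [set t | forall u, u \in us -> B u (t u)])) =
    \int[P]_(o in T @^-1` A) \big[*%E/1]_(u <- us)
      opt_life_law xi M (birth_place xi M s (T o) u) (B u).

Lemma sub_tree_sets (D D' : set label) : D `<=` D' ->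
  <<s tree_sets (R := R) (E := E) (W := W) D >> `<=` <<s tree_sets D' >>.
Proof.
move=> DD'; apply: sub_generated_sigma => A [u [B [Du mB ->]]].
by apply: sub_sigma_algebra; exists u, B; split => //; exact: DD'.
Qed.

Lemma measurable_sub_tree {d} {O : measurableType d} (D D' : set label)
    (T : O -> tree) : D `<=` D' ->
  measurable_fun setT (T : O -> tree_space D') ->
  measurable_fun setT (T : O -> tree_space D).
Proof. by move=> DD' mT _ A mA; apply: mT => //; exact: sub_tree_sets mA. Qed.

Lemma generations_particles n : generations n `<=` particles.
Proof. by move=> [|]. Qed.

Lemma measurable_tree_event (D : set label) (us : seq label)
    (B : label -> set (opt life)) :
  (forall u, u \in us -> D u) -> (forall u, measurable (B u)) ->
  <<s tree_sets D >> [set t : tree | forall u, u \in us -> B u (t u)].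
Proof.
move=> + mB; elim: us => [_|u us IH usD].
  rewrite (_ : [set _ | _] = setT); first exact: (@measurableT _ (tree_space D)).
  by apply/seteqP; split.
rewrite (_ : [set _ | _] = [set t | B u (t u)] `&`
    [set t | forall u, u \in us -> B u (t u)]); last first.
  apply/seteqP; split => t Bt.
    by split => [|v vus]; apply: Bt; rewrite inE ?eqxx// vus orbT.
  by move=> v; rewrite inE => /predU1P[->|]; [exact: Bt.1|exact: Bt.2].
apply: (@measurableI _ (tree_space D)).
  by apply: sub_sigma_algebra; exists u, (B u); split => //; exact/usD/mem_head.
by apply: IH => v vus; apply: usD; rewrite inE vus orbT.
Qed.

Lemma measurable_prod_opt_life_law n s (us : seq label)
    (B : label -> set (opt life)) : (forall u, u \in us -> size u = n.+1) ->
  (forall u, measurable (B u)) ->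
  measurable_fun setT (fun t : tree_space (R := R) (E := E) (W := W) (generations n) =>
    \big[*%E/1]_(u <- us) opt_life_law xi M (birth_place xi M s t u) (B u)).
Proof.
move=> + mB; elim: us => [_|u us IH usn].
  by apply: (eq_measurable_fun (cst 1)) => // t _; rewrite big_nil.
apply: (eq_measurable_fun (fun t : tree_space (generations n) =>
    opt_life_law xi M (birth_place xi M s t u) (B u) *
    \big[*%E/1]_(v <- us) opt_life_law xi M (birth_place xi M s t v) (B v))).
  by move=> t _; rewrite big_cons.
apply: emeasurable_funM; last by apply: IH => v vus; rewrite usn// inE vus orbT.
apply: (measurableT_comp (measurable_opt_life_law xi M (mB u))).
apply: measurable_birth_place => j v uv v0.
have := usn u (mem_head _ _); rewrite uv /= => -[vn].
by rewrite /generations/= vn leqnn andbT -vn lt0n size_eq0; exact/eqP.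
Qed.

Lemma prod_opt_life_law_ge0 s t (us : seq label) (B : label -> set (opt life)) :
  0 <= \big[*%E/1]_(u <- us) opt_life_law xi M (birth_place xi M s t u) (B u).
Proof. by apply: prode_ge0 => u _; exact: opt_life_law_ge0. Qed.

(** Gives stability under intersection of the pi-system used below. A label common to both lists
    must occur once, with both constraints on it, as the branching relation takes lists without
    duplicates. *)
Lemma generation_setI_uniq (us vs : seq label) (B C : label -> set (opt life)) :
  (forall u, measurable (B u)) -> (forall u, measurable (C u)) ->
  exists2 D : label -> set (opt life), (forall u, measurable (D u)) &
    [set t : tree | forall u, u \in us -> B u (t u)] `&`
    [set t : tree | forall u, u \in vs -> C u (t u)] =
    [set t : tree | forall u, u \in undup (us ++ vs) -> D u (t u)].
Proof.
move=> mB mC.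
exists (fun u => (if u \in us then B u else setT) `&`
                 (if u \in vs then C u else setT)).
  by move=> u; apply: measurableI; case: ifP.
apply/seteqP; split => [t [Bt Ct] u|t Dt].
  by rewrite mem_undup mem_cat; split; case: ifP => // ?; [exact: Bt|exact: Ct].
by split => u uin; have := Dt u; rewrite mem_undup mem_cat uin ?orbT => /(_ isT)[].
Qed.

Section uniqueness.
Context {d1 d2 : measure_display} {O1 : measurableType d1} {O2 : measurableType d2}.
Variables (P1 : probability O1 R) (P2 : probability O2 R).
Variables (T1 : O1 -> tree) (T2 : O2 -> tree) (s : seq E).
Hypothesis mT1 : measurable_fun setT (T1 : O1 -> tree_space particles).
Hypothesis mT2 : measurable_fun setT (T2 : O2 -> tree_space particles).
Hypotheses (b1 : branching_law P1 T1 s) (b2 : branching_law P2 T2 s).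

Let P12T : P1 setT = P2 setT. Proof. by rewrite !probability_setT. Qed.

Let P1oo : P1 setT < +oo. Proof. by rewrite probability_setT ltry. Qed.

Let mpre {d} {O : measurableType d} (T : O -> tree) n A :
  measurable_fun setT (T : O -> tree_space particles) ->
  <<s tree_sets (generations n) >> A -> measurable (T @^-1` A).
Proof.
move=> mT nA; rewrite -[X in measurable X]setTI; apply: mT => //.
exact: (sub_tree_sets (@generations_particles n)).
Qed.

Let mgen {d} {O : measurableType d} (T : O -> tree) n :
  measurable_fun setT (T : O -> tree_space particles) ->
  measurable_fun setT (T : O -> tree_space (generations n)).
Proof. exact/measurable_sub_tree/generations_particles. Qed.

Let unique_generation n A : <<s tree_sets (generations n) >> A ->
  P1 (T1 @^-1` A) = P2 (T2 @^-1` A).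
Proof.
elim: n A => [|n IH] A.
  (* No label has a size in the range for n = 0, so the generating family is empty and the equality
     of total masses decides. *)
  apply: eq_pushforward_generated => //.
  - by move=> B [[|? ?] [? []]].
  - by move=> B [[|? ?] [? []]].
  - by move=> B C [[|? ?] [? []]].
  - by move=> B [[|? ?] [? []]].
(* The branching relation gives the measure of the members of this pi-system,
   which generates the sigma-algebra of the first n.+1 generations. *)
pose G : set (set tree) := [set A | exists A0 us (B : label -> set (opt life)),
  [/\ <<s tree_sets (generations n) >> A0, uniq us,
   forall u, u \in us -> size u = n.+1, forall u, measurable (B u) &
   A = A0 `&` [set t | forall u, u \in us -> B u (t u)]]].
have gnS : generations n `<=` generations n.+1.
  by move=> u /andP[u0 un]; apply/andP; split => //; exact: leqW.
have GS : G `<=` <<s tree_sets (generations n.+1) >>.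
  move=> _ [A0 [us [B [A0n _ usn mB ->]]]].
  apply: (@measurableI _ (tree_space (generations n.+1))).
    exact: (sub_tree_sets gnS).
  by apply: measurable_tree_event => // u /usn un; rewrite /generations/= un leqnn.
have SG : <<s tree_sets (generations n.+1) >> `<=` <<s G >>.
  apply: sub_generated_sigma => _ [u [B [un mB ->]]]; apply: sub_sigma_algebra.
  have [un1|un1] := eqVneq (size u) n.+1.
    exists setT, [:: u], (fun _ => B); split => //.
    - exact: (@measurableT _ (tree_space (generations n))).
    - by move=> v; rewrite inE => /eqP ->.
    - rewrite setTI; apply/seteqP; split => t /=.
        by move=> Bt v; rewrite inE => /eqP ->.
      by apply; rewrite inE.
  exists [set t | B (t u)], [::], (fun _ => B); split => //.
  - apply: sub_sigma_algebra; exists u, B; split => //.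
    by move: un => /andP[u0]; rewrite leq_eqVlt (negbTE un1)/= ltnS /generations/= u0.
  - by rewrite (_ : [set t | forall v, _] = setT) ?setIT//; apply/seteqP; split.
move/SG; apply: eq_pushforward_generated => //.
- by move=> B /GS; exact: mpre.
- by move=> B /GS; exact: mpre.
- move=> _ _ [A0 [us [B [A0n us1 usn mB ->]]]] [C0 [vs [C [C0n vs1 vsn mC ->]]]].
  have [D mD BCD] := generation_setI_uniq us vs mB mC.
  exists (A0 `&` C0), (undup (us ++ vs)), D; split => //.
  + exact: (@measurableI _ (tree_space (generations n))).
  + exact: undup_uniq.
  + by move=> u; rewrite mem_undup mem_cat => /orP[/usn|/vsn].
  + by rewrite setIACA BCD.
move=> _ [A0 [us [B [A0n us1 usn mB ->]]]].
rewrite (b1 A0n us1 usn mB) (b2 A0n us1 usn mB).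
(* The integrand is a function of the first n generations, so its integral is taken against their
   image law, which is common to both sides by induction. *)
pose g t := \big[*%E/1]_(u <- us)
  opt_life_law xi M (birth_place xi M s t u) (B u).
have mg : measurable_fun setT (g : tree_space (generations n) -> \bar R).
  exact: measurable_prod_opt_life_law.
have pushg d (O : measurableType d) (P : probability O R) (T : O -> tree) :
    measurable_fun setT (T : O -> tree_space particles) ->
    \int[P]_(o in T @^-1` A0) g (T o) =
    \int[pushforward P (T : O -> tree_space (generations n))]_(t in A0) g t.
  move=> mT; rewrite (ge0_integral_pushforward (mgen mT))//.
    exact: measurable_funTS.
  by move=> t _; exact: prod_opt_life_law_ge0.
rewrite [LHS](pushg _ _ P1 T1 mT1) [RHS](pushg _ _ P2 T2 mT2).
apply: eq_measure_integral; [exact: mgen|exact: mgen|].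
by move=> ? ? C mC _; exact: IH.
Qed.

(** The sigma-algebras of the first n generations increase with n, so their union is a pi-system; it
    contains every cylinder over particles. *)
Lemma branching_law_unique A : <<s tree_sets particles >> A ->
  P1 (T1 @^-1` A) = P2 (T2 @^-1` A).
Proof.
pose G : set (set tree) := [set A | exists n, <<s tree_sets (generations n) >> A].
have SG : <<s tree_sets particles >> `<=` <<s G >>.
  apply: sub_generated_sigma => A0 [u [B [u0 mB ->]]]; apply: sub_sigma_algebra.
  exists (size u); apply: sub_sigma_algebra; exists u, B; split => //.
  by rewrite /generations/= leqnn andbT lt0n size_eq0; exact/eqP.
move=> /SG; apply: eq_pushforward_generated => //.
- by move=> B [n]; exact: mpre.
- by move=> B [n]; exact: mpre.
- move=> B C [n Bn] [m Cm]; exists (maxn n m).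
  apply: (@measurableI _ (tree_space (generations (maxn n m)))).
    apply: sub_tree_sets Bn => u /andP[u0 un]; apply/andP; split => //.
    by rewrite (leq_trans un)// leq_maxl.
  apply: sub_tree_sets Cm => u /andP[u0 un]; apply/andP; split => //.
  by rewrite (leq_trans un)// leq_maxr.
- by move=> B [n]; exact: unique_generation.
Qed.

End uniqueness.
End branching_law.

(** * Grafting of independent trees *)

(** Only the last entry, the index of the initial ancestor, is changed: a family is moved as a whole
    to another ancestor. *)
Fixpoint reroot (f : nat -> nat) (u : label) : label :=
  match u with
  | [::] => [::]
  | [:: i] => [:: f i]
  | j :: u' => j :: reroot f u'
  end.

Lemma reroot_cons f j u : u <> [::] -> reroot f (j :: u) = j :: reroot f u.
Proof. by case: u. Qed.

Lemma size_reroot f u : size (reroot f u) = size u.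
Proof. by elim: u => [|j [|i u] IH] //; rewrite reroot_cons//= IH. Qed.

Lemma reroot_eq0 f u : reroot f u = [::] -> u = [::].
Proof. by case: u => [|j [|i u]]. Qed.

Lemma last_reroot f u : u <> [::] -> last 0%N (reroot f u) = f (last 0%N u).
Proof.
elim: u => [|j [|i u] IH] // _; rewrite reroot_cons//.
have := IH (fun e => ltac:(discriminate e)).
by case: reroot (@reroot_eq0 f (i :: u)) => // /(_ erefl).
Qed.

Lemma reroot_comp f g u : reroot f (reroot g u) = reroot (f \o g) u.
Proof.
elim: u => [|j [|i u] IH] //; rewrite reroot_cons// [RHS]reroot_cons// -IH.
by rewrite reroot_cons// => /reroot_eq0.
Qed.

Lemma eq_reroot f g u : f (last 0%N u) = g (last 0%N u) -> reroot f u = reroot g u.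
Proof. 
elim: u => [|j [|i u] IH] // fg; first by rewrite /= [f _]fg.
by rewrite reroot_cons// [RHS]reroot_cons// IH.
Qed.

Lemma reroot_id u : reroot id u = u.
Proof. by elim: u => [|j [|i u] IH] //; rewrite reroot_cons// IH. Qed.

Lemma reroot_succnK : cancel (reroot succn) (reroot predn).
Proof. by move=> u; rewrite reroot_comp -[RHS]reroot_id; exact: eq_reroot. Qed.

Lemma reroot_prednK u : last 0%N u != 0%N -> reroot succn (reroot predn u) = u.
Proof.
move=> u0; rewrite reroot_comp -[RHS]reroot_id; apply: eq_reroot => /=.
by rewrite prednK// lt0n.
Qed.

(** * Integrals of products over sets that need not be rectangles *)

Section integral_product.
Context {R : realType} {d1 d2 : measure_display}.
Context {O1 : measurableType d1} {O2 : measurableType d2}.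
Variables (P1 : probability O1 R) (P2 : probability O2 R).
Local Open Scope ereal_scope.

Let integral_product1 (K : set (O1 * O2)) (f : O1 -> \bar R) (g : O2 -> \bar R) :
  measurable K -> measurable_fun setT f -> measurable_fun setT g ->
  (forall x, 0 <= f x) -> (forall y, 0 <= g y) ->
  \int[P1 \x P2]_(z in K) (f z.1 * g z.2) =
  \int[P1]_x (f x * \int[P2]_(y in xsection K x) g y).
Proof.
move=> mK mf mg f0 g0.
have mfg : measurable_fun setT (fun z : O1 * O2 => f z.1 * g z.2).
  by apply: emeasurable_funM; [exact: (measurableT_comp mf measurable_fst)|
    exact: (measurableT_comp mg measurable_snd)].
rewrite integral_mkcond fubini_tonelli1; first last.
- by move=> z; rewrite patchE; case: ifPn => // _; exact: mule_ge0.
- by apply/(measurable_restrictT _ mK); exact: measurable_funTS.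
apply: eq_integral => x _; rewrite /fubini_F/=.
rewrite -ge0_integralZl//; first last.
- exact: measurable_funTS.
- exact: measurable_xsection.
rewrite [RHS]integral_mkcond; apply: eq_integral => y _.
by rewrite !patchE mem_xsection.
Qed.

Let integral_product2 (K : set (O1 * O2)) (f : O1 -> \bar R) (g : O2 -> \bar R) :
  measurable K -> measurable_fun setT f -> measurable_fun setT g ->
  (forall x, 0 <= f x) -> (forall y, 0 <= g y) ->
  \int[P1 \x P2]_(z in K) (f z.1 * g z.2) =
  \int[P2]_y ((\int[P1]_(x in ysection K y) f x) * g y).
Proof.
move=> mK mf mg f0 g0.
have mfg : measurable_fun setT (fun z : O1 * O2 => f z.1 * g z.2).
  by apply: emeasurable_funM; [exact: (measurableT_comp mf measurable_fst)|
    exact: (measurableT_comp mg measurable_snd)].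
rewrite integral_mkcond fubini_tonelli2; first last.
- by move=> z; rewrite patchE; case: ifPn => // _; exact: mule_ge0.
- by apply/(measurable_restrictT _ mK); exact: measurable_funTS.
apply: eq_integral => y _; rewrite /fubini_G/=.
rewrite muleC -ge0_integralZl//; first last.
- exact: measurable_funTS.
- exact: measurable_ysection.
rewrite [RHS]integral_mkcond; apply: eq_integral => x _.
by rewrite !patchE mem_ysection/= muleC.
Qed.

(** The integral over [K] does not separate, but with one factor frozen it is an iterated integral
    whose inner part runs over a section of [K]. So g and then f can be exchanged separately. *)
Lemma eq_integral_product (K : set (O1 * O2)) (f f' : O1 -> \bar R)
    (g g' : O2 -> \bar R) :
  measurable K -> measurable_fun setT f -> measurable_fun setT f' ->
  measurable_fun setT g -> measurable_fun setT g' ->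
  (forall x, 0 <= f x) -> (forall x, 0 <= f' x) ->
  (forall y, 0 <= g y) -> (forall y, 0 <= g' y) ->
  (forall y, \int[P1]_(x in ysection K y) f x = \int[P1]_(x in ysection K y) f' x) ->
  (forall x, \int[P2]_(y in xsection K x) g y = \int[P2]_(y in xsection K x) g' y) ->
  \int[P1 \x P2]_(z in K) (f z.1 * g z.2) = \int[P1 \x P2]_(z in K) (f' z.1 * g' z.2).
Proof.
move=> mK mf mf' mg mg' f0 f'0 g0 g'0 ff' gg'.
transitivity (\int[P1 \x P2]_(z in K) (f z.1 * g' z.2)).
  rewrite (integral_product1 mK mf mg f0 g0) (integral_product1 mK mf mg' f0 g'0).
  by apply: eq_integral => x _; rewrite gg'.
rewrite (integral_product2 mK mf mg' f0 g'0) (integral_product2 mK mf' mg' f'0 g'0).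
by apply: eq_integral => y _; rewrite ff'.
Qed.

End integral_product.

Section graft.
Context {R : realType} {dE dW : measure_display}.
Context {E : measurableType dE} {W : measurableType dW}.
Variables (xi : markov_process (R := R) E W) (M : branching_mechanism (R := R) E).
Local Open Scope ereal_scope.
Notation tree := (tree (R := R) (E := E) (W := W)).
Notation life := (life (R := R) (E := E) (W := W)).

(* The initial particle 0 is that of t1; the initial particle i.+1 is the initial
   particle i of t2. *)
Definition graft (t1 t2 : tree) : tree :=
  fun u => if last 0%N u == 0%N then t1 u else t2 (reroot predn u).

Definition child_place (o : opt life) (j : nat) : option E :=
  if o is Some (w, e, y) then
    if branch_place xi M w e is Some _ then onth (y : seq E) j else None
  else None.

Lemma birth_place_cons s T j u : u <> [::] ->
  birth_place xi M s T (j :: u) = child_place (T u) j.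
Proof. by case: u. Qed.

(** A particle and its parent share their last entry, so every recursion along ancestors stays
    inside one of the two trees. The same reason serves [split_time_graft] and [place_graft]. *)
Lemma birth_place_graft a s t1 t2 u :
  birth_place xi M (a :: s) (graft t1 t2) u =
  if last 0%N u == 0%N then birth_place xi M [:: a] t1 u
  else birth_place xi M s t2 (reroot predn u).
Proof.
case: u => [|j u]; first by [].
have [->|/eqP u0] := eqVneq u [::]; first by case: j.
rewrite birth_place_cons// (_ : last 0%N (j :: u) = last 0%N u); last by case: u u0.
rewrite /graft; case: ifPn => ul; first by rewrite birth_place_cons.
rewrite reroot_cons// birth_place_cons// => /reroot_eq0; exact: u0.
Qed.

Lemma split_time_graft t1 t2 u : split_time xi M (graft t1 t2) u =
  if last 0%N u == 0%N then split_time xi M t1 u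
  else split_time xi M t2 (reroot predn u).
Proof.
elim: u => [|j u IH]; first by [].
have [->|/eqP u0] := eqVneq u [::].
  by rewrite [LHS]/= /graft; case: ifPn.
have ul : last 0%N (j :: u) = last 0%N u by case: u u0 {IH}.
rewrite [LHS]/= IH {1}/graft ul; case: ifPn => // _.
by rewrite reroot_cons.
Qed.

Lemma place_graft t1 t2 t u : place xi M (graft t1 t2) t u =
  if last 0%N u == 0%N then place xi M t1 t u else place xi M t2 t (reroot predn u).
Proof.
case: u => [|j u]; first by [].
have [->|/eqP u0] := eqVneq u [::].
  by rewrite !place_cons /= /graft; case: ifPn.
have ul : last 0%N (j :: u) = last 0%N u by case: u u0.
rewrite place_cons !split_time_graft {1}/graft ul; case: ifPn => _.
  by rewrite place_cons.
by rewrite reroot_cons// place_cons.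
Qed.

Lemma measurable_graft {d} {X : measurableType d} (f1 f2 : X -> tree) (D : set label) :
  (forall u, D u -> D (reroot predn u)) ->
  measurable_fun setT (f1 : X -> tree_space D) ->
  measurable_fun setT (f2 : X -> tree_space D) ->
  measurable_fun setT ((fun x => graft (f1 x) (f2 x)) : X -> tree_space D).
Proof.
move=> DD mf1 mf2; apply: measurable_fun_tree => u Du.
rewrite /graft; case: (last 0%N u == 0%N).
  by apply: (measurableT_comp (measurable_tree_coord Du)).
by apply: (measurableT_comp (measurable_tree_coord (DD _ Du))).
Qed.

Section law.
Context {d1 d2 : measure_display} {O1 : measurableType d1} {O2 : measurableType d2}.
Variables (P1 : probability O1 R) (P2 : probability O2 R).
Variables (T1 : O1 -> tree) (T2 : O2 -> tree).
Hypothesis mT1 : measurable_fun setT (T1 : O1 -> tree_space particles).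
Hypothesis mT2 : measurable_fun setT (T2 : O2 -> tree_space particles).

Lemma prod_opt_life_law_graft a s (us : seq label) (B : label -> set (opt life)) t1 t2 :
  \big[*%E/1]_(u <- us)
     opt_life_law xi M (birth_place xi M (a :: s) (graft t1 t2) u) (B u) =
  (\big[*%E/1]_(u <- [seq u <- us | last 0%N u == 0%N])
     opt_life_law xi M (birth_place xi M [:: a] t1 u) (B u)) *
  (\big[*%E/1]_(v <- [seq reroot predn u | u <- us & last 0%N u != 0%N])
     opt_life_law xi M (birth_place xi M s t2 v) (B (reroot succn v))).
Proof.
rewrite (bigID (fun u => last 0%N u == 0%N))/= big_map !big_filter; congr (_ * _).
  by apply: eq_bigr => u u0; rewrite birth_place_graft u0.
by apply: eq_bigr => u u0; rewrite birth_place_graft (negbTE u0) reroot_prednK.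
Qed.

(** The event on generation n + 1 is a rectangle, its labels being sorted by family. The past event
    [K] is not, but freezing one tree leaves an event of the first n generations of the other, to
    which the branching relation of that tree applies. *)
Lemma branching_law_graft a s :
  branching_law xi M P1 T1 [:: a] -> branching_law xi M P2 T2 s ->
  branching_law xi M (P1 \x P2) (fun o => graft (T1 o.1) (T2 o.2)) (a :: s).
Proof.
move=> b1 b2 n A us B An us1 usn mB.
set vs := [seq u <- us | last 0%N u == 0%N].
set ws := [seq reroot predn u | u <- us & last 0%N u != 0%N].
pose C v := B (reroot succn v).
have vs1 : uniq vs by exact: filter_uniq.
have ws1 : uniq ws.
  rewrite map_inj_in_uniq ?filter_uniq// => u v; rewrite !mem_filter.
  by move=> /andP[u0 _] /andP[v0 _] /(congr1 (reroot succn)); rewrite !reroot_prednK.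
have vsn u : u \in vs -> size u = n.+1 by rewrite mem_filter => /andP[_ /usn].
have wsn u : u \in ws -> size u = n.+1.
  by move=> /mapP[v]; rewrite mem_filter => /andP[_ /usn vn] ->; rewrite size_reroot.
have mC u : measurable (C u) by exact: mB.
have mT1n := measurable_sub_tree (@generations_particles n) mT1.
have mT2n := measurable_sub_tree (@generations_particles n) mT2.
pose gr (o : O1 * O2) := graft (T1 o.1) (T2 o.2).
have Dgen u : generations n u -> generations n (reroot predn u).
  by rewrite /generations/= size_reroot.
have mgr : measurable_fun setT (gr : O1 * O2 -> tree_space (generations n)).
  by apply: measurable_graft; [exact: Dgen|exact: (measurableT_comp mT1n measurable_fst)|
    exact: (measurableT_comp mT2n measurable_snd)].
pose K := gr @^-1` A.
have mK : measurable K by rewrite -[X in measurable X]setTI; exact: mgr.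
have Kx x : xsection K x = T2 @^-1` [set t2 | A (graft (T1 x) t2)].
  by apply/seteqP; split => y; rewrite /xsection/= inE.
have Ky y : ysection K y = T1 @^-1` [set t1 | A (graft t1 (T2 y))].
  by apply/seteqP; split => x; rewrite /ysection/= inE.
have AKx t1 : <<s tree_sets (generations n) >> [set t2 | A (graft t1 t2)].
  rewrite -[X in <<s _ >> X]setTI.
  by apply: (@measurable_graft _ (tree_space (generations n)) (cst t1) id _ Dgen);
    [exact: measurable_cst|exact: measurable_id|exact: measurableT|].
have AKy t2 : <<s tree_sets (generations n) >> [set t1 | A (graft t1 t2)].
  rewrite -[X in <<s _ >> X]setTI.
  by apply: (@measurable_graft _ (tree_space (generations n)) id (cst t2) _ Dgen);
    [exact: measurable_id|exact: measurable_cst|exact: measurableT|].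
pose S1 := T1 @^-1` [set t | forall u, u \in vs -> B u (t u)].
pose S2 := T2 @^-1` [set t | forall u, u \in ws -> C u (t u)].
have mS1 : measurable S1.
  rewrite -[X in measurable X]setTI; apply: mT1 => //.
  by apply: measurable_tree_event => // u /vsn; case: u.
have mS2 : measurable S2.
  rewrite -[X in measurable X]setTI; apply: mT2 => //.
  by apply: measurable_tree_event => // u /wsn; case: u.
have -> : (fun o => graft (T1 o.1) (T2 o.2)) @^-1`
    (A `&` [set t | forall u, u \in us -> B u (t u)]) =
    (S1 `*` S2) `&` K.
  apply/seteqP; split => o.
    move=> [Ao Bo]; split => //; split.
      by move=> u; rewrite mem_filter => /andP[u0 /Bo]; rewrite /graft u0.
    move=> v /mapP[u]; rewrite mem_filter => /andP[u0 uus] ->; rewrite /C reroot_prednK//.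
    by have := Bo _ uus; rewrite /graft (negbTE u0).
  move=> [[S1o S2o] Ao]; split => // u uus; rewrite /graft; case: ifPn => u0.
    by apply: S1o; rewrite mem_filter u0.
  have := S2o (reroot predn u); rewrite /C reroot_prednK//; apply.
  by apply: map_f; rewrite mem_filter u0.
(* By Fubini's theorem the indicators of S1 and S2 can be replaced one after the
   other by their conditional probabilities given the first n generations. *)
rewrite -integral_indic//; last exact: measurableX.
transitivity (\int[P1 \x P2]_(z in K) ((\1_S1 z.1)%:E * (\1_S2 z.2)%:E)).
  apply: eq_integral => z _; rewrite -EFinM; congr EFin.
  by rewrite !indicE in_setX; case: (_ \in _); case: (_ \in _); rewrite ?mul1r ?mul0r.
pose f' o := \big[*%E/1]_(u <- vs)
  opt_life_law xi M (birth_place xi M [:: a] (T1 o) u) (B u).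
pose g' o := \big[*%E/1]_(u <- ws)
  opt_life_law xi M (birth_place xi M s (T2 o) u) (C u).
transitivity (\int[P1 \x P2]_(z in K) (f' z.1 * g' z.2)); last first.
  by apply: eq_integral => z _; rewrite prod_opt_life_law_graft.
apply: (@eq_integral_product _ _ _ _ _ P1 P2 K (fun o => (\1_S1 o)%:E) f'
  (fun o => (\1_S2 o)%:E) g') => //.
- by apply/measurable_EFinP; exact: measurable_indic.
- by apply: (measurableT_comp (measurable_prod_opt_life_law xi M [:: a] vsn mB)).
- by apply/measurable_EFinP; exact: measurable_indic.
- by apply: (measurableT_comp (measurable_prod_opt_life_law xi M s wsn mC)).
- by move=> x; exact: prod_opt_life_law_ge0.
- by move=> x; exact: prod_opt_life_law_ge0.
- move=> y; rewrite integral_indic//; last exact: measurable_ysection.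
  by rewrite Ky -(b1 _ _ _ _ (AKy _) vs1 vsn mB) preimage_setI setIC.
- move=> x; rewrite integral_indic//; last exact: measurable_xsection.
  by rewrite Kx -(b2 _ _ _ _ (AKx _) ws1 wsn mC) preimage_setI setIC.
Qed.

End law.
End graft.

(** * Superposition and extinction of populations *)

Section population_graft.
Context {R : realType} {dE dW : measure_display}.
Context {E : measurableType dE} {W : measurableType dW}.
Variables (xi : markov_process (R := R) E W) (M : branching_mechanism (R := R) E).
Local Open Scope ereal_scope.
Notation tree := (tree (R := R) (E := E) (W := W)).
Notation life := (life (R := R) (E := E) (W := W)).
Notation place := (place xi M).
Notation population := (population xi M).

(** Grafting with the empty tree erases every family but that of particle 0, which is exactly what
    [graft] retains of its first argument. *)
Definition solo (t : tree) : tree := graft t (fun=> None).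

Lemma place_None (t : tree) (s : R) u : t u = None -> place t s u = None.
Proof. by case: u => //= j u ->. Qed.

Lemma place_solo (t : tree) (s : R) u :
  place (solo t) s u = if last 0%N u == 0%N then place t s u else None.
Proof. by rewrite /solo place_graft [place (fun=> None) _ _]place_None. Qed.

Lemma population_graft (t1 t2 : tree) (s : R) :
  population (graft t1 t2) s = madd (population (solo t1) s) (population t2 s).
Proof.
apply: eq_measure; apply/funext => B.
rewrite [RHS]measure_addE !populationE.
have occ0 t u := occupation_ge0 xi M t s B u.
rewrite (esumID [set u | last 0%N u == 0%N])// !setTI.
rewrite [in RHS](esumID [set u | last 0%N u == 0%N])// !setTI.
rewrite [X in _ = _ + X + _]esum1 ?adde0; last first.
  by move=> u /= /negP u0; rewrite /occupation place_solo (negbTE u0).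
congr (_ + _).
  by apply: eq_esum => u /= u0; rewrite /occupation place_solo place_graft u0.
(* The root has last entry 0 by default, so it falls on the side of [t1]. On the side of [t2] the
   reindexing by [reroot succn] reaches only particles, and the root, where nobody lives, is
   discarded. *)
rewrite [RHS](esumID particles)// !setTI [X in _ = _ + X]esum1 ?adde0; last first.
  by move=> u /= /contrapT ->.
rewrite (reindex_esum particles _ (reroot succn)).
  apply: eq_esum => u u0; rewrite /occupation place_graft last_reroot//=.
  by rewrite reroot_succnK.
split.
- by move=> u u0 /=; rewrite last_reroot.
- by move=> u v _ _; apply: (can_inj reroot_succnK).
- move=> u /= /negP u0; exists (reroot predn u); last exact: reroot_prednK.
  by move=> /reroot_eq0 u00; rewrite u00 in u0.
Qed.

Lemma eq_population (t1 t2 : tree) :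
  (forall s u, place t1 s u = place t2 s u) -> population t1 = population t2.
Proof.
move=> t12; apply/funext => s; apply: eq_measure; apply/funext => B.
by rewrite !populationE; apply: eq_esum => u _; rewrite /occupation t12.
Qed.

Lemma population_eq0 (t : tree) (s : R) :
  (population t s : {measure set E -> \bar R}) setT = 0 <->
  forall u, place t s u = None.
Proof.
rewrite populationE; split=> [t0 u|t0]; last first.
  by apply: esum1 => u _; rewrite /occupation t0.
have := occupation_ge0 xi M t s setT u.
have : occupation xi M t s setT u <= 0.
  rewrite -t0 (esumID [set u])//; last by move=> *; exact: occupation_ge0.
  rewrite setTI esum_set1 ?occupation_ge0// leeDl// esum_ge0// => *.
  exact: occupation_ge0.
rewrite /occupation; case: place => // x; rewrite /dirac/= indicT.
by rewrite lee_fin ler10.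
Qed.

(** [mbp_tree_closed] for an arbitrary tree, so that it can be passed on to [solo]. The initial
    positions are irrelevant to particles that have a parent, whence the list [[::]]. *)
Definition descended (t : tree) : Prop := forall j u, u <> [::] ->
  t (j :: u) <> None -> birth_place xi M [::] t (j :: u) <> None.

Lemma descended_parent t j u : descended t -> u <> [::] ->
  t (j :: u) <> None -> t u <> None.
Proof.
move=> dt u0 tju tu; have := dt j u u0 tju.
by rewrite birth_place_cons// tu.
Qed.

Lemma descended_root t u : descended t -> u <> [::] -> t u <> None ->
  t [:: last 0%N u] <> None.
Proof.
move=> dt; elim: u => [|j u IH] // _ tju.
have [u0|/eqP u0] := eqVneq u [::]; first by rewrite u0 in tju *.
rewrite (_ : last 0%N (j :: u) = last 0%N u); last by case: u u0 {IH tju}.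
exact/IH/(descended_parent dt u0 tju).
Qed.

Lemma descended_solo t : descended t -> descended (solo t).
Proof.
move=> dt j u u0; rewrite birth_place_cons// /solo/graft.
have -> : last 0%N (j :: u) = last 0%N u by case: u u0.
by case: ifPn => // _ /(dt _ _ u0); rewrite birth_place_cons.
Qed.

(** Everyone is born by an extinct time s, by induction on generations. A parent born by s but
    branching later would be visible at s: its branching place lies in E, and the cemetery is
    absorbing, so the motion is not killed before. *)
Lemma split_time_le_extinct t (s : R) j u : (0 <= s)%R -> descended t ->
  (forall v, place t s v = None) -> t (j :: u) <> None ->
  split_time xi M t u <= s%:E.
Proof.
move=> s0 dt ts; elim: u j => [|i u IH] j tju; first by rewrite /= lee_fin.
have tu : t (i :: u) <> None by exact: descended_parent tju.
have su := IH i tu.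
have := dt j (i :: u) ltac:(by []) tju; rewrite birth_place_cons//.
case tiu : (t (i :: u)) tu => [[[w e] y]|//] _.
have -> : split_time xi M t (i :: u) = split_time xi M t u + branch_age xi M w e.
  by rewrite /= tiu.
have := split_time_ge0 xi M t u; have := branch_age_ge0 xi M w e.
rewrite /child_place /branch_place; case ba : branch_age => [r| |] //.
case st : (split_time xi M t u) su => [a| |] // su; rewrite !lee_fin => r0 a0.
case xir : (xi r w) => [z|//] _; rewrite leNgt; apply/negP => sar.
have := ts (i :: u); rewrite place_cons tiu /= st su tiu ba -EFinD lte_fin sar/=.
move=> xis; suff : xi r w = None by rewrite xir.
apply: motion_absorbed xis; first by rewrite subr_ge0 -lee_fin.
by rewrite lerBlDl ltW.
Qed.

(** Nobody is born after s, and a particle unseen at s that has not yet branched sits in the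
    cemetery for ever. *)
Lemma extinct_later t (s s' : R) : descended t -> (0 <= s)%R -> (s <= s')%R ->
  (forall u, place t s u = None) -> forall u, place t s' u = None.
Proof.
move=> dt s0 ss' ts [|j u] //; rewrite place_cons.
case tju : (t _) => [l|//]; case: ifPn => // /andP[_ s'u].
have su : split_time xi M t u <= s%:E.
  by apply: (split_time_le_extinct (j := j)) => //; rewrite tju.
have := ts (j :: u); rewrite place_cons tju su/= (le_lt_trans _ s'u) ?lee_fin// => xis.
apply: motion_absorbed xis; last by rewrite lerB.
rewrite subr_ge0; have := split_time_ge0 xi M t u; move: su.
by case: split_time => [r| |]//=; rewrite ?lee_fin ?leey_eq.
Qed.
End population_graft.

(** * The branching property and the conditioned laws *)

Lemma eq_measure_ae {d : measure_display} {T : measurableType d} {R : realType}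
    (mu : {measure set T -> \bar R}) (A B : set T) :
  measurable A -> measurable B -> {ae mu, forall x, A x <-> B x} ->
  mu A = mu B.
Proof.
move=> mA mB [N [mN N0 AB]].
have le (C D : set T) : measurable C -> measurable D ->
    (forall x, (A x <-> B x) -> C x -> D x) -> (mu C <= mu D)%E.
  move=> mC mD CD; apply: (@le_trans _ _ (mu (D `|` N))).
    apply: le_measure; rewrite ?inE//; first exact: measurableU.
    move=> x Cx; have [ABx|ABx] := pselect (A x <-> B x).
      by left; exact: CD Cx.
    by right; exact: AB.
  apply: (@le_trans _ _ (mu D + mu N)%E); first exact: measureU2.
  by rewrite N0 adde0.
by apply/eqP; rewrite eq_le !le// => x [].
Qed.

Section mbp_theory.
Context {R : realType} {dE dW dO : measure_display}.
Context {E : measurableType dE} {W : measurableType dW} {O : measurableType dO}.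
Context {P : R -> (E -> R) -> E -> R} {G : (E -> R) -> E -> R}.
Variable X : mbp W O P G.
Local Open Scope ereal_scope.
Notation xi := (mbp_motion X).
Notation M := (mbp_mechanism X).
Notation T := (mbp_tree X).
Notation law := (mbp_law X).
Notation population := (population xi M).

Lemma measurable_mbp_tree :
  measurable_fun setT (T : O -> tree_space (R := R) (E := E) (W := W) particles).
Proof. by apply: measurable_fun_tree => u _; exact: mbp_tree_measurable. Qed.

Lemma mbp_branching_law s : branching_law xi M (law s) T s.
Proof.
move=> n A us B An us1 usn mB; rewrite preimage_setI.
apply: (@mbp_branching _ _ _ _ _ _ _ _ _ X s n (T @^-1` A) us B) => //.
(* The sample space with only the information of the first n generations; measurability of the tree
   from it puts the preimage of [A] in the sigma-algebra demanded by [mbp_branching]. *)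
pose OG : measurableType _ := g_sigma_algebraType (generation_sets T n).
have mT : measurable_fun setT
    (T : OG -> tree_space (R := R) (E := E) (W := W) (generations n)).
  apply: measurable_fun_generated => _ [u [C [un mC ->]]].
  by apply: sub_sigma_algebra; exists u, C.
by have := mT measurableT A An; rewrite setTI.
Qed.

Lemma measurable_mbp_path : measurable_fun setT (mbp_path X : O -> measure_path R E).
Proof. exact: (measurableT_comp (measurable_population xi M) measurable_mbp_tree). Qed.

Definition solo_path (o : O) : measure_path R E := population (solo (T o)).

Lemma measurable_solo_path : measurable_fun setT solo_path.
Proof.
apply: (measurableT_comp (measurable_population xi M)
  (g := (fun o => solo (T o)) : O -> tree_space particles)).
apply: measurable_graft; [|exact: measurable_mbp_tree|exact: measurable_cst].
by move=> u u0 /reroot_eq0.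
Qed.

(** The closure condition on trees does not cover initial particles. The branching relation at n = 0
    does: an index beyond [s] has birth place [None], and its life then has the Dirac law at
    [None]. *)
Lemma mbp_root_ae s :
  {ae law s, forall o, forall i, (size s <= i)%N -> T o [:: i] = None}.
Proof.
apply: ae_foralln => i; have [si|si] := leqP (size s) i; last exact: aeW.
pose B : set (opt (life (R := R) (E := E) (W := W))) := [set l | isSome l].
have mB : measurable B.
  rewrite -[X in measurable X]setTI.
  exact: (@measurable_isSome _ _ measurableT [set true]).
have h := @mbp_branching_law s 0%N setT [:: [:: i]] (fun=> B).
exists (T @^-1` [set t | forall u, u \in [:: [:: i]] -> B (t u)]).
have E0 : T @^-1` [set t | forall u, u \in [:: [:: i]] -> B (t u)] =
  (fun o => T o [:: i]) @^-1` B.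
  apply/seteqP; split => o To; first by apply: To; rewrite inE.
  by move=> u; rewrite inE => /eqP ->.
split.
- rewrite E0 -[X in measurable X]setTI; exact: mbp_tree_measurable.
- move: h; rewrite setTI preimage_setT => ->//; first last.
  + by move=> u; rewrite inE => /eqP ->.
  + exact: (@measurableT _ (tree_space _)).
  apply: integral0_eq => o _; rewrite big_seq1 /= onth_default//=.
  by rewrite diracE memNset.
- move=> o /= h0; apply: contrapT => /= h1; apply: h0 => _.
  apply: contrapT => h2; apply: h1 => u; rewrite inE => /eqP ->.
  by rewrite /B/=; case: (T o _) h2.
Qed.

Lemma mbp_descended o : descended xi M (T o).
Proof. by move=> j u; exact: mbp_tree_closed. Qed.

Lemma mbp_tree_root (o : O) n :
  (forall i, (n <= i)%N -> T o [:: i] = None) ->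
  forall u, u <> [::] -> (n <= last 0%N u)%N -> T o u = None.
Proof.
move=> To u u0 nu; apply: contrapT => /(descended_root (@mbp_descended o) u0).
by apply; exact: To.
Qed.

Lemma mbp_path_nil_ae :
  {ae law [::], forall o, mbp_path X o = (fun=> (mzero : measures R E))}.
Proof.
apply: filterS (mbp_root_ae [::]) => o To; apply/funext => s; apply: eq_measure.
apply/funext => B; rewrite populationE esum1// => u _; rewrite /occupation.
have [->//|/eqP u0] := eqVneq u [::].
by rewrite place_None// (mbp_tree_root To).
Qed.

Lemma mbp_path_solo_ae a : {ae law [:: a], forall o, mbp_path X o = solo_path o}.
Proof.
apply: filterS (mbp_root_ae [:: a]) => o To; apply: eq_population => s u.
rewrite place_solo; case: eqP => // /eqP u0; rewrite place_None//.
by apply: (mbp_tree_root To); [case: u u0|rewrite lt0n].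
Qed.

Lemma mbp_path_solo a (A : set (measure_path R E)) : measurable A ->
  law [:: a] (solo_path @^-1` A) = law [:: a] (mbp_path X @^-1` A).
Proof.
move=> mA; apply: eq_measure_ae.
- by rewrite -[X in measurable X]setTI; exact: measurable_solo_path.
- by rewrite -[X in measurable X]setTI; exact: measurable_mbp_path.
- by apply: filterS (mbp_path_solo_ae a) => o /= ->.
Qed.

(** With [solo_path] in the first factor, the path of the grafted tree is the sum of the two paths
    at every outcome, not merely almost surely. *)
Lemma mbp_law_cons a s (A : set (measure_path R E)) : measurable A ->
  law (a :: s) (mbp_path X @^-1` A) =
  (law [:: a] \x law s) ((fun o => (fun t =>
     madd (solo_path o.1 t) (mbp_path X o.2 t)) : measure_path R E) @^-1` A).
Proof.
move=> mA.
pose gr (o : O * O) := graft (T o.1) (T o.2).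
have mgr : measurable_fun setT
    (gr : O * O -> tree_space (R := R) (E := E) (W := W) particles).
  apply: measurable_graft.
  - by move=> u u0 /reroot_eq0.
  - exact: (measurableT_comp measurable_mbp_tree measurable_fst).
  - exact: (measurableT_comp measurable_mbp_tree measurable_snd).
have mpA : <<s tree_sets particles >> (population @^-1` A).
  by have := measurable_population xi M measurableT mA; rewrite setTI.
rewrite [LHS](branching_law_unique (P1 := law (a :: s)) (P2 := law [:: a] \x law s)
  (T2 := gr) (s := a :: s) measurable_mbp_tree mgr (@mbp_branching_law _) _ mpA).
  congr ((_ \x _) _); apply/seteqP; split => o /=; rewrite /gr.
    rewrite (_ : population _ = fun t => madd (solo_path o.1 t) (mbp_path X o.2 t))//.
    by apply/funext => t; rewrite population_graft.
  rewrite (_ : population _ = fun t => madd (solo_path o.1 t) (mbp_path X o.2 t))//.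
  by apply/funext => t; rewrite population_graft.
apply: branching_law_graft; [exact: measurable_mbp_tree|exact: measurable_mbp_tree| |];
  exact: mbp_branching_law.
Qed.

(** Integer times suffice for the path of a descended tree, which stays extinct; the event then
    depends on countably many coordinates and is measurable. *)
Definition path_dies (x : measure_path R E) : Prop :=
  exists m : nat, (x m%:R%R : {measure set E -> \bar R}) setT = 0.

Lemma measurable_path_eval t (B : set E) : (0 <= t)%R -> measurable B ->
  measurable_fun setT
    (fun x : measure_path R E => (x t : {measure set E -> \bar R}) B).
Proof.
move=> t0 mB _ U mU; rewrite setTI.
by apply: sub_sigma_algebra; exists t, B, U.
Qed.

Lemma measurable_path_dies : measurable (path_dies : set (measure_path R E)).
Proof.
rewrite (_ : path_dies = \bigcup_(m : nat) (fun x : measure_path R E =>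
   (x m%:R%R : {measure set E -> \bar R}) setT) @^-1` [set 0]).
  apply: bigcupT_measurable => m; rewrite -[X in measurable X]setTI.
  by apply: measurable_path_eval.
by apply/seteqP; split => x [m]; exists m.
Qed.

Lemma path_diesP (t : tree (R := R) (E := E) (W := W)) : descended xi M t ->
  path_dies (population t) <->
  exists2 s, (0 <= s)%R & forall u, place xi M t s u = None.
Proof.
move=> dt; split=> [[m /population_eq0 tm]|[s s0 ts]]; first by exists m%:R%R.
exists (Num.bound s); apply/population_eq0.
by apply: (extinct_later dt s0 _ ts); exact/ltW/archi_boundP.
Qed.

Lemma extinction_timeP o : extinction_time X o < +oo <-> path_dies (mbp_path X o).
Proof.
split=> [/ereal_inf_lt[_ [s [s0 Xs] _] _]|[m Xm]].
  by apply/(path_diesP (@mbp_descended o)); exists s => //; exact/population_eq0.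
apply: (@le_lt_trans _ _ m%:R%:E); last exact: ltry.
by apply: ereal_inf_lbound; exists m%:R%R.
Qed.

(** In reversed notation the descendants of [[:: 0]] are the labels with that suffix, that is, the
    nonempty labels with last entry 0: the family kept by [solo]. *)
Lemma dies_outP o : dies_out xi M (T o) 0 [:: 0%N] <-> path_dies (solo_path o).
Proof.
rewrite path_diesP; last exact/descended_solo/mbp_descended.
split=> -[s s0 os]; exists s => // u.
  rewrite place_solo; case: eqP => // u0.
  have [->//|/eqP u1] := eqVneq u [::].
  apply: os; apply/suffixP; exists (belast (head 0%N u) (behead u)).
  rewrite cats1 -u0; case: u u1 {u0} => // j u _ /=; exact: lastI.
move=> /suffixP[v uv]; have := os u; rewrite place_solo uv last_cat/=.
by [].
Qed.

Lemma extinction_probE a :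
  extinction_prob X a = fine (law [:: a] (solo_path @^-1` path_dies)).
Proof.
rewrite /extinction_prob mbp_path_solo; last exact: measurable_path_dies.
congr (fine (law _ _)); apply/seteqP; split => o /=; by rewrite extinction_timeP.
Qed.

Lemma conditioned_lawE a c A : measurable A ->
  conditioned_law X a c A = (fine (law [:: a] (mbp_path X @^-1` A `&`
    (if c is Doomed then solo_path @^-1` path_dies
     else ~` (solo_path @^-1` path_dies)))) /
    (if c is Doomed then extinction_prob X a else 1 - extinction_prob X a))%R.
Proof.
move=> mA; rewrite /conditioned_law /conditional.
have mD : measurable (solo_path @^-1` path_dies).
  rewrite -[X in measurable X]setTI; apply: measurable_solo_path => //.
  exact: measurable_path_dies.
have -> : [set o | mark_at X [:: 0%N] 0 o = c] =
   if c is Doomed then solo_path @^-1` path_dies else ~` (solo_path @^-1` path_dies).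
  apply/seteqP; rewrite /mark_at; case: c; split => o /=; case: asboolP => //.
  - by move=> h _ /dies_outP.
  - by move=> h1 h2; exfalso; apply: h2; exact/dies_outP.
  - by move=> /dies_outP.
  - by move=> h1 /dies_outP.
congr (_ / _)%R; case: c => /=; last by rewrite extinction_probE.
by rewrite probability_setC// extinction_probE fineB//; exact: fin_num_measure.
Qed.

End mbp_theory.

(** * Sums of independent paths *)

Section path_sum.
Context {R : realType} {dE : measure_display} {E : measurableType dE}.
Local Notation path := (measure_path R E).
Local Notation zero := (mzero : measures R E).

Lemma measurable_fun_path {d} {T : measurableType d} (f : T -> path) :
  (forall t B, (0 <= t)%R -> measurable B ->
    measurable_fun setT (fun x => (f x t : {measure set E -> \bar R}) B)) ->
  measurable_fun setT f.
Proof.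
move=> mf; apply: measurable_fun_generated => _ [t [B [U [t0 mB mU ->]]]].
by rewrite -[X in measurable X]setTI; exact: mf.
Qed.

Definition path_add (p : path * path) : path := fun t => madd (p.1 t) (p.2 t).

Lemma measurable_path_add : measurable_fun setT path_add.
Proof.
apply: measurable_fun_path => t B t0 mB.
apply: (eq_measurable_fun (fun p : path * path =>
    (p.1 t : {measure set E -> \bar R}) B + (p.2 t : {measure set E -> \bar R}) B)%E).
  by move=> p _; rewrite [RHS]measure_addE.
by apply: emeasurable_funD;
  [apply: (measurableT_comp (measurable_path_eval t0 mB) measurable_fst)
  |apply: (measurableT_comp (measurable_path_eval t0 mB) measurable_snd)].
Qed.

Lemma measurable_path_sum {d} {T : measurableType d} n (Y : 'I_n -> T -> path) :
  (forall i, measurable_fun setT (Y i)) ->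
  measurable_fun setT ((fun o t => \big[@madd R _ E/zero]_(i < n) Y i o t) : T -> path).
Proof.
elim: n Y => [|n IH] Y mY.
  apply: (eq_measurable_fun (cst ((fun=> zero) : path))) => //.
  by move=> o _; apply/funext => t; rewrite big_ord0.
pose S o : path := fun t => \big[@madd R _ E/zero]_(i < n) Y (lift ord0 i) o t.
apply: (eq_measurable_fun (path_add \o (fun o => (Y ord0 o, S o)))).
  by move=> o _; apply/funext => t; rewrite big_ord_recl.
apply: (measurableT_comp measurable_path_add); apply: measurable_fun_pair => //.
by apply: (IH (fun i => Y (lift ord0 i))).
Qed.

End path_sum.

Section law_sum.
Context {R : realType} {dE dW dO dO' : measure_display}.
Context {E : measurableType dE} {W : measurableType dW} {O : measurableType dO}.
Context {P : R -> (E -> R) -> E -> R} {G : (E -> R) -> E -> R}.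
Variable X : mbp W O P G.
Context {O' : measurableType dO'} (Q : probability O' R).
Local Open Scope ereal_scope.
Local Notation path := (measure_path R E).
Local Notation zero := (mzero : measures R E).

Let law_path x (A : set path) := mbp_law X x (mbp_path X @^-1` A).

(* The event C carries a condition on the first path through the induction. *)
Lemma law_sum n (x : n.-tuple E) (Y : 'I_n -> O' -> path) (C : set O') :
  measurable C -> (forall i, measurable_fun setT (Y i)) ->
  (forall A : 'I_n -> set path, (forall i, measurable (A i)) ->
    Q (C `&` [set o | forall i, A i (Y i o)]) =
    Q C * \prod_(i < n) law_path [:: tnth x i] (A i)) ->
  forall A : set path, measurable A ->
    Q (C `&` [set o | A (fun t => \big[@madd R _ E/zero]_(i < n) Y i o t)]) =
    Q C * law_path x A.
Proof.
elim: n x Y C => [|n IH] x Y C mC mY QY A mA.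
  rewrite (tuple0 x) (_ : [set o | _] = [set o | A (fun=> zero)]); last first.
    have S0 o : (fun t => \big[@madd R _ E/zero]_(i < 0) Y i o t) = (fun=> zero).
      by apply/funext => t; rewrite big_ord0.
    by apply/seteqP; split => o /=; rewrite S0.
  (* The empty sum is the zero path, and so is, almost surely, the path without initial particles;
     hence [A] has law 1 or 0 according to whether it contains that path. *)
  have [Az|Az] := pselect (A (fun=> zero)).
    rewrite (_ : [set _ | _] = setT) ?setIT; last by apply/seteqP; split.
    suff -> : law_path [tuple] A = 1 by rewrite mule1.
    rewrite -(probability_setT (mbp_law X [::])); apply: eq_measure_ae => //.
      by rewrite -[X in measurable X]setTI; exact: measurable_mbp_path.
    by apply: filterS (mbp_path_nil_ae X) => o /= ->.
  rewrite (_ : [set _ | _] = set0) ?setI0 ?measure0; last by apply/seteqP; split.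
  suff -> : law_path [tuple] A = 0 by rewrite mule0.
  rewrite -(measure0 (mbp_law X [::])); apply: eq_measure_ae => //.
    by rewrite -[X in measurable X]setTI; exact: measurable_mbp_path.
  by apply: filterS (mbp_path_nil_ae X) => o /= ->.
case/tupleP: x QY => a x QY.
pose Y' i := Y (lift ord0 i).
pose S o : path := fun t => \big[@madd R _ E/zero]_(i < n) Y' i o t.
have mS : measurable_fun setT S by apply: measurable_path_sum => i; exact: mY.
have law_setT y : law_path y setT = 1 by rewrite /law_path preimage_setT probability_setT.
have QC (A1 A2 : set path) : measurable A1 -> measurable A2 ->
    Q (C `&` [set o | A1 (Y ord0 o) /\ A2 (S o)]) =
    Q C * (law_path [:: a] A1 * law_path x A2).
  move=> mA1 mA2.
  pose C1 := C `&` Y ord0 @^-1` A1.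
  have mC1 : measurable C1.
    by apply: measurableI => //; rewrite -[X in measurable X]setTI; exact: mY.
  (* Placing [A1] at index 0 turns the product hypothesis for n + 1 paths into the one for the last
     n paths on the event [C1], as the induction requires. *)
  pose F (B : 'I_n -> set path) k := if unlift ord0 k is Some i then B i else A1.
  have QF (B : 'I_n -> set path) : (forall i, measurable (B i)) ->
      Q (C1 `&` [set o | forall i, B i (Y' i o)]) =
      Q C * law_path [:: a] A1 * \prod_(i < n) law_path [:: tnth x i] (B i).
    move=> mB.
    have F0 : F B ord0 = A1 by rewrite /F unlift_none.
    have FS i : F B (lift ord0 i) = B i by rewrite /F liftK.
    have := QY (F B); rewrite big_ord_recl F0 tnth0.
    under eq_bigr do rewrite FS tnthS.
    rewrite muleA => <-; last by move=> k; rewrite /F; case: unlift.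
    congr (Q _); apply/seteqP; split => o.
      move=> [[Co A1o] Bo]; split => // k; rewrite /F.
      by case: unliftP => [i ->|->//]; exact: Bo.
    move=> [Co Fo]; split; first split => //.
      by have := Fo ord0; rewrite F0.
    by move=> i; have := Fo (lift ord0 i); rewrite FS.
  have QC1 : Q C1 = Q C * law_path [:: a] A1.
    have := QF (fun=> setT) (fun=> measurableT).
    rewrite big1 ?mule1 => [<-|i _]; last exact: law_setT.
    by congr (Q _); apply/seteqP; split => o; [move=> C1o; split|case].
  have QF1 (B : 'I_n -> set path) : (forall i, measurable (B i)) ->
      Q (C1 `&` [set o | forall i, B i (Y' i o)]) =
      Q C1 * \prod_(i < n) law_path [:: tnth x i] (B i).
    by move=> mB; rewrite QF// QC1.
  rewrite muleA -QC1 -(IH x Y' C1 mC1 (fun i => mY _) QF1 _ mA2).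
  by congr (Q _); rewrite /C1 -setIA.
pose pi : probability (O * O)%type R := mbp_law X [:: a] \x mbp_law X x.
pose f1 o : path * path := (Y ord0 o, S o).
pose f2 (o : O * O) : path * path := (solo_path X o.1, mbp_path X o.2).
pose c : {nonneg R} := NngNum (fine_ge0 (measure_ge0 Q C)).
have cE : c%:num%:E = Q C by rewrite /= fineK// fin_num_measure.
pose GX : set (set (path * path)) :=
  [set A1 `*` A2 | A1 in measurable & A2 in measurable].
have mf1 : measurable_fun setT f1 by exact: measurable_fun_pair.
have mf2 : measurable_fun setT f2.
  by apply: measurable_fun_pair;
   [exact: (measurableT_comp (measurable_solo_path X) measurable_fst)
   |exact: (measurableT_comp (measurable_mbp_path X) measurable_snd)].
have mGX (A' : set (path * path)) : GX A' -> measurable A'.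
  by move=> [A1 mA1 [A2 mA2 <-]]; exact: measurableX.
(* On rectangles the pair of the first path and the remaining sum, restricted to [C], has mass Q(C)
   times a product law. The extension to all events is needed because the preimage of [A] under
   addition is no rectangle. *)
have key : forall A' : set (path * path), <<s GX >> A' ->
    mrestr Q mC (f1 @^-1` A') = mscale c pi (f2 @^-1` A').
  apply: eq_pushforward_generated.
  - by move=> A' /mGX mA'; rewrite -[X in measurable X]setTI; exact: mf1.
  - by move=> A' /mGX mA'; rewrite -[X in measurable X]setTI; exact: mf2.
  - move=> _ _ [A1 mA1 [A2 mA2 <-]] [B1 mB1 [B2 mB2 <-]]; rewrite -setXI.
    exists (A1 `&` B1); first exact: measurableI.
    by exists (A2 `&` B2) => //; exact: measurableI.
  - change (Q (setT `&` C) = c%:num%:E * pi setT).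
    by rewrite setTI cE probability_setT mule1.
  - change (Q (setT `&` C) < +oo).
    by rewrite setTI ltey_eq fin_num_measure.
  - move=> _ [A1 mA1 [A2 mA2 <-]].
    change (Q (f1 @^-1` (A1 `*` A2) `&` C) = c%:num%:E * pi (f2 @^-1` (A1 `*` A2))).
    rewrite setIC cE [LHS]QC//; congr (_ * _).
    rewrite (_ : f2 @^-1` _ = (solo_path X @^-1` A1) `*` (mbp_path X @^-1` A2))//.
    rewrite /law_path -(mbp_path_solo X a mA1); apply/esym; apply: product_measure1E.
    + by rewrite -[X in measurable X]setTI; exact: measurable_solo_path.
    + by rewrite -[X in measurable X]setTI; exact: measurable_mbp_path.
have mAdd : <<s GX >> (@path_add R _ E @^-1` A).
  have := measurable_path_add measurableT mA; rewrite setTI.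
  by rewrite measurable_prod_measurableType.
have : Q (f1 @^-1` (@path_add R _ E @^-1` A) `&` C) =
    c%:num%:E * pi (f2 @^-1` (@path_add R _ E @^-1` A)) := key _ mAdd.
rewrite setIC cE /law_path mbp_law_cons//.
have SE o : (fun t => \big[@madd R _ E/zero]_(i < n.+1) Y i o t) = path_add (f1 o).
  by apply/funext => t; rewrite big_ord_recl.
move=> <-; congr (Q _); apply/seteqP; split => o -[Co Ao]; split => //.
  by rewrite /= -SE.
by rewrite /= SE.
Qed.

End law_sum.

(** * Mixtures selected by independent Bernoulli variables *)

Lemma measure_bigcup_fin {d : measure_display} {T : measurableType d} {R : realType}
    (mu : {measure set T -> \bar R}) (I : finType) (F : I -> set T) :
  (forall i, measurable (F i)) -> trivIset setT F ->
  mu (\bigcup_i F i) = (\sum_(i : I) mu (F i))%E.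
Proof.
move=> mF tF; have finI : finite_set [set: I] by exact: finite_finset.
rewrite measure_fin_bigcup//.
rewrite (fsbig_finite _ _ finI).
apply/perm_big/uniq_perm; [exact: finmap.fset_uniq|exact: index_enum_uniq|] => i.
by rewrite mem_index_enum in_fset_set//; apply: mem_set.
Qed.

(** The sample space is partitioned by the outcomes of all the Boolean variables. On each cell the
    selected variables are known, and independence factorises the probability. *)
Lemma independent_mixture {R : realType} {d dT : measure_display}
    {O : measurableType d} {T : measurableType dT} (Q : probability O R) n
    (B : 'I_n -> {mfun O >-> bool}) (U V : 'I_n -> {mfun O >-> T}) :
  mutually_independent Q (I := ('I_n + 'I_n + 'I_n)%type)
     (fun k => match k with
               | inl (inl i) => g_sigma_algebra_preimage (B i)
               | inl (inr i) => g_sigma_algebra_preimage (U i)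
               | inr i => g_sigma_algebra_preimage (V i)
               end) ->
  forall A : 'I_n -> set T, (forall i, measurable (A i)) ->
  fine (Q [set o | forall i, A i (if B i o then U i o else V i o)]) =
  \prod_(i < n) (fine (Q (B i @^-1` [set true])) * fine (Q (U i @^-1` A i)) +
                 fine (Q (B i @^-1` [set false])) * fine (Q (V i @^-1` A i))).
Proof.
move=> indep A mA.
(* A variable that [b] does not select gets the whole space, so that independence is applied to all
   3n variables at once and the idle ones contribute the factor 1. *)
pose F (b : {ffun 'I_n -> bool}) (k : 'I_n + 'I_n + 'I_n) : set O :=
  match k with
  | inl (inl i) => B i @^-1` [set b i]
  | inl (inr i) => U i @^-1` (if b i then A i else setT)
  | inr i => V i @^-1` (if b i then setT else A i)
  end.
have FG b k : (match k with
               | inl (inl i) => g_sigma_algebra_preimage (B i)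
               | inl (inr i) => g_sigma_algebra_preimage (U i)
               | inr i => g_sigma_algebra_preimage (V i)
               end) (F b k).
  case: k => [[i|i]|i]; rewrite /F; (eexists; last exact: setTI) => //.
    by case: (b i).
  by case: (b i).
have mF b k : measurable (F b k).
  case: k => [[i|i]|i]; rewrite /F -[X in measurable X]setTI.
  - exact: measurable_funP.
  - by apply: measurable_funP => //; case: (b i).
  - by apply: measurable_funP => //; case: (b i).
pose S b : set O := [set o | forall k, F b k o].
have mS b : measurable (S b).
  rewrite (_ : S b = \bigcap_(k in setT) F b k); last first.
    by apply/seteqP; split => o So k //; exact: So.
  by apply: fin_bigcap_measurable.
have QS b : fine (Q (S b)) = \prod_(i < n) (if b i then
    fine (Q (B i @^-1` [set true])) * fine (Q (U i @^-1` A i)) else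
    fine (Q (B i @^-1` [set false])) * fine (Q (V i @^-1` A i))).
  have := indep [set: _]%SET (F b) (fun k _ => FG b k).
  rewrite (_ : [set w | _] = S b); last first.
    by apply/seteqP; split => o So k => [|_]; apply: So; rewrite ?finset.in_setT.
  move=> ->; rewrite (eq_bigl predT) => [|k]; last by rewrite finset.in_setT.
  rewrite !big_sumType/= -!big_split/=; apply: eq_bigr => i _.
  by case: (b i); rewrite preimage_setT probability_setT /= mulr1.
rewrite (_ : [set o | _] = \bigcup_b S b); last first.
  apply/seteqP; split => o.
    move=> Ao; exists [ffun i => B i o] => //.
    move=> [[i|i]|i]; rewrite /F ffunE //=; have := Ao i; by case: (B i o).
  move=> [b _ Sbo] i; have := Sbo (inl (inl i)); rewrite /F/= => ->.
  by have := Sbo (inl (inr i)); have := Sbo (inr i); rewrite /F/=; case: (b i).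
rewrite measure_bigcup_fin//; last first.
  move=> b c _ _ [z [Sb Sc]]; apply/ffunP => i.
  by have := Sb (inl (inl i)); have := Sc (inl (inl i)); rewrite /F/= => <- <-.
rewrite -sum_fine//; last by move=> b _; exact: fin_num_measure.
rewrite (eq_bigr _ (fun b _ => QS b)).
(* Each factor is a sum over one Boolean; distributivity expands the product into a sum over all
   outcome vectors, one per cell. *)
under [RHS]eq_bigr => i _.
  rewrite (_ : _ + _ = \sum_(c : bool) (if c then
    fine (Q (B i @^-1` [set true])) * fine (Q (U i @^-1` A i)) else
    fine (Q (B i @^-1` [set false])) * fine (Q (V i @^-1` A i)))); last first.
    by rewrite big_bool.
  over.
by rewrite bigA_distr_bigA.
Qed.

Theorem theorem2p1
  (R : realType) (d : nat) (E : set 'rV[R]_d) (openE : open E)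
  (neE : E !=set0)
  (dW dO : measure_display) (W : measurableType dW) (O : measurableType dO)
  (P : R -> (state neE -> R) -> state neE -> R)
  (G : (state neE -> R) -> state neE -> R)
  (X : mbp W O P G)
  (w_inf : 0 < inf (range (extinction_prob X)))
  (w_lt1 : forall x, extinction_prob X x < 1)
  (rate_bounded : exists C, forall x, rate (mbp_mechanism X) x <= C)
  (n : nat) (x : n.-tuple (state neE))
  (dO' : measure_display) (O' : measurableType dO') (Q : probability O' R)
  (B : 'I_n -> {mfun O' >-> bool})
  (Xup Xdown : 'I_n -> {mfun O' >-> measure_path R (state neE)})
  (B_law : forall i b,
     Q (B i @^-1` b) = bernoulli_prob (1 - extinction_prob X (tnth x i)) b)
  (Xup_law : forall i A, measurable A ->
     Q (Xup i @^-1` A) = (conditioned_law X (tnth x i) Prolific A)%:E)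
  (Xdown_law : forall i A, measurable A ->
     Q (Xdown i @^-1` A) = (conditioned_law X (tnth x i) Doomed A)%:E)
  (indep : mutually_independent Q (I := ('I_n + 'I_n + 'I_n)%type)
     (fun k => match k with
               | inl (inl i) => g_sigma_algebra_preimage (B i)
               | inl (inr i) => g_sigma_algebra_preimage (Xup i)
               | inr i => g_sigma_algebra_preimage (Xdown i)
               end)) :
  equal_in_law (mbp_law X x) (mbp_path X)
    Q (fun o t => \big[@madd R _ (state neE)/mzero : measures R (state neE)]_(i < n)
                    madd (mscaleb (B i o) (Xup i o t))
                         (mscaleb (~~ B i o) (Xdown i o t))).
Proof.
have w0 y : 0 < extinction_prob X y.
  (* [inf] is a lower bound because the range is bounded below, here by 0. *)
  apply: (lt_le_trans w_inf); apply: ge_inf; last by exists y.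
  by exists 0 => _ [z _ <-]; rewrite /extinction_prob fine_ge0.
pose Y i o : measure_path R (state neE) := fun t =>
  madd (mscaleb (B i o) (Xup i o t)) (mscaleb (~~ B i o) (Xdown i o t)).
(* Exactly one of the two coefficients is 1, so the sum is a choice between the two paths. *)
have YE i o : Y i o = if B i o then Xup i o else Xdown i o.
  apply/funext => t; apply: eq_measure; apply/funext => A.
  rewrite [LHS]measure_addE.
  have mE b (m : measures R (state neE)) :
      (mscaleb b m : {measure set (state neE) -> \bar R}) A =
      ((b%:R : R)%:E * (m : {measure set (state neE) -> \bar R}) A)%E by [].
  by rewrite !mE; case: (B i o); rewrite /= mul1e mul0e ?adde0 ?add0e.
have mY i : measurable_fun setT (Y i).
  rewrite (_ : Y i = fun o => if B i o then Xup i o else Xdown i o); last first.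
    by apply/funext => o; exact: YE.
  by apply: measurable_fun_ifT; exact: measurable_funP.
have p01 i : 0 <= 1 - extinction_prob X (tnth x i) <= 1.
  by rewrite subr_ge0 ltW//= lerBlDr lerDl ltW.
have Qfin (D : set O') : measurable D -> Q D = (fine (Q D))%:E.
  by move=> mD; rewrite fineK// fin_num_measure.
have bT i : fine (Q (B i @^-1` [set true])) = 1 - extinction_prob X (tnth x i).
  by rewrite B_law bernoulli_probE// !diracE mem_set// memNset// mule1 mule0 adde0.
have bF i : fine (Q (B i @^-1` [set false])) = extinction_prob X (tnth x i).
  rewrite B_law bernoulli_probE// !diracE memNset// mem_set// mule1 mule0 add0e /=.
  exact: (subKr 1).
have joint (A : 'I_n -> set (measure_path R (state neE))) :
    (forall i, measurable (A i)) ->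
    Q (setT `&` [set o | forall i, A i (Y i o)]) =
    (Q setT * \prod_(i < n) mbp_law X [:: tnth x i] (mbp_path X @^-1` A i))%E.
  move=> mA.
  have mpA i : measurable (mbp_path X @^-1` A i).
    by rewrite -[X in measurable X]setTI; exact: measurable_mbp_path.
  have mD : measurable (solo_path X @^-1` @path_dies R _ (state neE)).
    rewrite -[X in measurable X]setTI; apply: measurable_solo_path => //.
    exact: measurable_path_dies.
  rewrite probability_setT mul1e setTI.
  rewrite (_ : [set o | _] =
      [set o | forall i, A i (if B i o then Xup i o else Xdown i o)]); last first.
    by apply/seteqP; split => o Ao i; have := Ao i; rewrite YE.
  have mAY : measurable [set o | forall i, A i (if B i o then Xup i o else Xdown i o)].
    rewrite (_ : [set _ | _] = \bigcap_(i in setT) (Y i @^-1` A i)); last first.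
      by apply/seteqP; split => o Ao i; have := Ao i; rewrite /= YE // => /(_ Logic.I).
    apply: fin_bigcap_measurable => // i _.
    by rewrite -[X in measurable X]setTI; exact: mY.
  rewrite Qfin// (independent_mixture indep mA) -prodEFin; apply: eq_bigr => i _.
  rewrite bT bF Xup_law// Xdown_law// !conditioned_lawE//=.
  (* The weights cancel the denominators of the conditional laws. What remains is the mass of the
     path event on survival and on extinction, which add up to the unconditioned law of one path. *)
  have mulK (p q : R) : p != 0 -> p * (q / p) = q.
    by move=> p0; rewrite mulrC divfK.
  have pn : 1 - extinction_prob X (tnth x i) != 0 by rewrite lt0r_neq0// subr_gt0.
  rewrite (mulK _ _ pn) (mulK _ _ (lt0r_neq0 (w0 _))).
  have mI := measurableI _ _ (mpA i) mD.
  have mC := measurableD (mpA i) mD; rewrite setDE in mC.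
  have fI := fin_num_measure (mbp_law X [:: tnth x i]) _ mI.
  have fC := fin_num_measure (mbp_law X [:: tnth x i]) _ mC.
  rewrite -(fineD fC fI) fineK; last by rewrite fin_numD fC fI.
  by rewrite -setDE -measureDI.
(* The auxiliary event of the induction starts as the whole space. *)
move=> A mA; have := law_sum measurableT mY joint mA.
by rewrite setTI probability_setT mul1e => <-.
Qed.
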